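(* Let $p$ be a prime, $m\ge 1$ and $r$ integers with $r^p\equiv 1 \pmod m$, and let $G=\langle x, y\mid x^p=y^m=1,\ x^{-1}yx=y^r\rangle$ (so $G\cong C_p\ltimes C_m$ and $|G|=pm$). Assume that $p$ is the smallest prime divisor of $|G|$ and that $\gcd(p(r-1), m)=1$. Then $\mathsf d(G)=m+p-2$ and $\mathsf E(G)=\mathsf d(G)+|G|$.
   Context: A sequence over a finite multiplicatively written group $G$ is a finite unordered list of elements of $G$ with repetition allowed (an element of the free abelian monoid on $G$); its length is the number of terms. For a sequence $S=g_1\cdot\ldots\cdot g_\ell$, $\pi(S)=\{g_{\tau(1)}\cdots g_{\tau(\ell)}:\tau \text{ a permutation of } [1,\ell]\}$ is its set of products. $S$ is product-one if $1\in\pi(S)$. A subsequence is obtained by taking some of the terms (with multiplicity). The small Davenport constant $\mathsf d(G)$ is the maximal integer $\ell$ such that there is a sequence of length $\ell$ over $G$ having no nonempty product-one subsequence. $\mathsf E(G)$ is the smallest integer $t$ such that every sequence of length $t$ over $G$ contains a product-one subsequence of length $|G|$. *)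

(* Defs.v *)
From mathcomp Require Import all_boot all_order all_algebra all_fingroup.
Set Implicit Arguments. Unset Strict Implicit. Unset Printing Implicit Defensive.

(* Sequences over G are represented as lists (seq gT) all of whose terms lie
   in G; they are considered up to reordering, which is built into the
   notions below (subsequences are sub-multisets, products range over all
   orderings). *)

Section ProductOne.
Variable gT : finGroupType.

Definition seq_over (G : {set gT}) (S : seq gT) : bool := all (mem G) S.

Definition product_one (S : seq gT) : Prop :=
  exists t : seq gT, perm_eq t S /\ (\prod_(g <- t) g)%g = 1%g.

Definition subsequence (T S : seq gT) : Prop := exists b : bitseq, T = mask b S.

Definition product_one_free (S : seq gT) : Prop :=
  forall T, subsequence T S -> T <> [::] -> ~ product_one T.

Definition d_prop (G : {set gT}) (l : nat) : Prop :=
  exists S, seq_over G S /\ size S = l /\ product_one_free S.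

Definition is_small_davenport (G : {set gT}) (l : nat) : Prop :=
  d_prop G l /\ forall l', l < l' -> ~ d_prop G l'.

Definition E_prop (G : {set gT}) (t : nat) : Prop :=
  forall S, seq_over G S -> size S = t ->
    exists T, subsequence T S /\ size T = #|G| /\ product_one T.

Definition is_E_const (G : {set gT}) (t : nat) : Prop :=
  E_prop G t /\ forall t', t' < t -> ~ E_prop G t'.

End ProductOne.

(* Main.v *)
Require Import Defs.
From mathcomp Require Import all_boot all_order all_algebra all_fingroup cyclic finfield.
From mathcomp Require Import zify.
Import GRing.Theory Num.Theory.
Set Implicit Arguments. Unset Strict Implicit. Unset Printing Implicit Defensive.

(* Put N = <y>; it is cyclic of order m, it has index p, and G \ N acts on it
   without nontrivial fixed points.

   Davenport constant.  Cut a sequence into segments with product in N that are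
   minimal, so that the proper prefixes of a segment u lie in distinct cosets of
   N.  Unless the product of u is 1, its cyclic rotations have |u| distinct
   products; adding 1 to each of these sets and multiplying, Scherk's inequality
   (|X| + |Y| <= |XY| + 1 when 1 = 1 * 1 is the only factorization of 1) yields
   more than |N| products from m + p - 1 terms, unless some subsequence has
   product 1.

   E(G), for pm + m + p - 2 terms.

   (a) Many terms outside N.  Cut the sequence into m + (m - 1)/p blocks of p
   terms with product in N, more than (m - 1)/p of which consist of terms of one
   coset gN <> N.  Any block may be inserted between two terms of such a coset
   block, which conjugates its product by an arbitrary power of x.  So it is
   enough to select m blocks whose products, each replaced by a suitable
   conjugate, multiply to 1; as the conjugates of a nontrivial element number p,
   this follows from Cauchy-Davenport for m prime, and then for all m by
   induction on the number of prime factors.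

   (b) Few terms outside N.  Let H <= N be minimal such that H = N or fewer than
   |N : H| - 1 of the terms in N lie outside H.  By minimality, and by Kneser's
   stabilizer argument, fewer than |H| of the terms in H already have all of H
   as set of subproducts.  A product-one subsequence modulo H of the other
   terms, of suitable length and not contained in N, is completed by terms of H;
   moving c in H across a term g outside N changes the product by a conjugate
   of c^-1 c^g, and c |-> c^-1 c^g permutes H, so the product can be made 1. *)

(** * Sumsets: Scherk and Cauchy-Davenport *)

Section SetProducts.
Local Open Scope group_scope.
Variables (gT : finGroupType) (A : {group gT}).
Hypothesis abA : abelian A.
Implicit Types X Y : {set gT}.

(** Dyson's transform moves to [X] those translates [e * z], [z] in [Y], that are new to it. No new
    products arise: if [z] is moved and [v] stays, then [e * v] is in [X] and
    [(e * z) * v = (e * v) * z]. *)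
Lemma dyson_transform X Y (e : gT) (Y1 := [set z in Y | e * z \notin X]) :
    X \subset A -> Y \subset A -> e \in A ->
  #|X :|: e *: Y1| + #|Y :\: Y1| = #|X| + #|Y| /\
  (X :|: e *: Y1) * (Y :\: Y1) \subset X * Y.
Proof.
move=> sXA sYA Ae; have sY1 : Y1 \subset Y by apply/subsetP=> z; rewrite inE => /andP[].
split.
  rewrite cardsU disjoint_setI0 ?cards0 ?subn0 ?card_lcoset; last first.
    rewrite disjoint_sym disjoint_subset; apply/subsetP=> _ /lcosetP[z Y1z ->].
    by move: Y1z; rewrite !inE => /andP[].
  by rewrite cardsD (setIidPr sY1); have := subset_leq_card sY1; lia.
apply/subsetP=> _ /mulsgP[u v Xu /setDP[Yv nY1v] ->].
have Xev : e * v \in X by move: nY1v; rewrite inE Yv /= negbK.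
case/setUP: Xu => [Xu | /lcosetP[z Y1z ->]]; first exact: mem_mulg.
have Yz := subsetP sY1 z Y1z.
rewrite -mulgA (centsP abA z (subsetP sYA _ Yz) v (subsetP sYA _ Yv)) mulgA.
exact: mem_mulg.
Qed.

(** Induction on [#|Y|]: a Dyson transform at some [x0] in [X] shrinks [Y], keeps [1] in both sets
    and keeps the factorization of [1] unique. *)
Lemma scherk X Y :
    X \subset A -> Y \subset A -> 1 \in X -> 1 \in Y ->
    (forall x y, x \in X -> y \in Y -> x * y = 1 -> y = 1) ->
  #|X| + #|Y| <= #|X * Y|.+1.
Proof.
have [n] := ubnP #|Y|; elim: n X Y => // n IHn X Y leYn sXA sYA X1 Y1 uniq1.
have [Y'0 | [y Yy]] := set_0Vmem (Y :\ 1).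
  have ->: Y = [set 1].
    by apply/eqP; rewrite eqEsubset sub1set Y1 -setD_eq0 Y'0 eqxx.
  by rewrite cards1 addn1 card_rcoset.
case/setD1P: Yy => y1 Yy; have Ay := subsetP sYA y Yy.
(* Otherwise [X] is closed under multiplication by [y], hence contains [y^-1], and [y^-1 * y] is a
   second factorization of [1]. *)
have [x0 Xx0 nXx0y] : exists2 x0, x0 \in X & x0 * y \notin X.
  have [/exists_inP // | /exists_inPn clX] := boolP [exists x in X, x * y \notin X].
  have Xyk k : y ^+ k \in X.
    by elim: k => // k IHk; rewrite expgSr; have := clX _ IHk; rewrite negbK.
  case/eqP: y1; apply: (uniq1 y^-1) => //; last exact: mulVg.
  by rewrite invg_expg.
have [cardE subE] := dyson_transform sXA sYA (subsetP sXA _ Xx0).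
set Z := [set z in Y | _] in cardE subE.
have Zy : y \in Z by rewrite inE Yy.
have nZ1 : 1 \notin Z by rewrite inE mulg1 Xx0 andbF.
have sZY : Z \subset Y by apply/subsetP=> z; rewrite inE => /andP[].
rewrite -cardE; apply: leq_trans (leq_trans (_ : _ <= #|(X :|: x0 *: Z) * (Y :\: Z)|.+1) _).
- exact: leqnn.
- apply: IHn.
  + apply: leq_trans (leYn : #|Y| <= n); apply: proper_card; rewrite properEneq subsetDl andbT.
    by apply: contraTneq Zy => YE; move: Yy; rewrite -{1}YE inE => /andP[].
  + rewrite subUset sXA; apply/subsetP=> _ /lcosetP[z Zz ->].
    by rewrite groupM ?(subsetP sXA x0) // (subsetP sYA) ?(subsetP sZY).
  + by apply: subset_trans sYA; apply: subsetDl.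
  + by rewrite inE X1.
  + by rewrite inE nZ1.
  + move=> u v /setUP[Xu | /lcosetP[z Zz ->]] /setDP[Yv nZv].
      exact: uniq1.
    have Xv : x0 * v \in X by move: nZv; rewrite inE Yv negbK.
    have Yz := subsetP sZY z Zz.
    rewrite -mulgA (centsP abA z (subsetP sYA _ Yz) v (subsetP sYA _ Yv)) mulgA.
    by move=> /(uniq1 _ _ Xv Yz) z1; rewrite -z1 Zz in nZ1.
- by rewrite ltnS subset_leq_card.
Qed.

(** The same induction, with [e = x0 * y0^-1] so that [y0] survives in [Y]. If no [x0] is usable,
    [X] is stable under [y0^-1 * y], which generates [A], so [X] is as large as [A]. *)
Lemma cauchy_davenport X Y :
    prime #|A| -> X \subset A -> Y \subset A -> X != set0 -> Y != set0 ->
  (#|A| <= #|X * Y|) || (#|X| + #|Y| <= #|X * Y|.+1).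
Proof.
move=> prA; have [n] := ubnP #|Y|; elim: n X Y => // n IHn X Y leYn sXA sYA X0 Y0.
have [y0 Yy0] := set0Pn _ Y0.
have [Y'0 | [y Yy]] := set_0Vmem (Y :\ y0).
  have ->: Y = [set y0].
    by apply/eqP; rewrite eqEsubset sub1set Yy0 -setD_eq0 Y'0 eqxx.
  by rewrite cards1 addn1 card_rcoset leqnn orbT.
case/setD1P: Yy => y1 Yy; have Ay := subsetP sYA y Yy; have Ay0 := subsetP sYA _ Yy0.
have [/exists_inP[x0 Xx0 nXx0y] | ] := boolP [exists x in X, x * (y0^-1 * y) \notin X].
- have Ax0 := subsetP sXA _ Xx0.
  have Ae : x0 * y0^-1 \in A by rewrite groupM ?groupV.
  have [cardE subE] := dyson_transform sXA sYA Ae.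
  set e := x0 * y0^-1 in Ae cardE subE; set Z := [set z in Y | _] in cardE subE.
  have Zy : y \in Z by rewrite inE Yy -mulgA.
  have nZ1 : y0 \notin Z by rewrite inE /e mulgKV Xx0 andbF.
  have sZY : Z \subset Y by apply/subsetP=> z; rewrite inE => /andP[].
  have: (#|A| <= #|(X :|: e *: Z) * (Y :\: Z)|) ||
      (#|X :|: e *: Z| + #|Y :\: Z| <= #|(X :|: e *: Z) * (Y :\: Z)|.+1).
    apply: IHn.
    + apply: leq_trans (leYn : #|Y| <= n); apply: proper_card; rewrite properEneq subsetDl andbT.
      by apply: contraTneq Zy => YE; move: Yy; rewrite -{1}YE inE => /andP[].
    + rewrite subUset sXA; apply/subsetP=> _ /lcosetP[z Zz ->].
      by rewrite groupM // (subsetP sYA) ?(subsetP sZY).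
    + by apply: subset_trans sYA; apply: subsetDl.
    + by apply: contraNneq X0 => XZ0; rewrite -subset0 -XZ0 subsetUl.
    + by apply/set0Pn; exists y0; rewrite inE nZ1.
  rewrite cardE => /orP[h | h]; apply/orP; [left | right]; apply: leq_trans h _.
    exact: subset_leq_card.
  by rewrite ltnS subset_leq_card.
- move/exists_inPn=> clX; apply/orP; left.
  have [x0 Xx0] := set0Pn _ X0.
  set z := y0^-1 * y in clX; have Az : z \in A by rewrite groupM ?groupV.
  have z1 : z != 1 by apply: contraNneq y1; rewrite /z => /(canRL (mulKVg _)); rewrite mulg1 => ->.
  have Xyk k : x0 * z ^+ k \in X.
    elim: k => [|k IHk]; first by rewrite mulg1.
    by rewrite expgSr mulgA; have := clX _ IHk; rewrite negbK.
  have AE : <[z]> = A.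
    apply/eqP; rewrite eqEcard cycle_subG Az /=.
    have := cardSg (_ : <[z]> \subset A); rewrite cycle_subG => /(_ Az).
    by case/primeP: prA => _ dvA /dvA /orP[|/eqP->//]; rewrite -[_ == _]trivg_card1 cycle_eq1 (negPf z1).
  apply: leq_trans (_ : #|X| <= _).
    rewrite -(card_lcoset A x0) subset_leq_card // -AE.
    by apply/subsetP=> _ /lcosetP[_ /cycleP[k ->] ->].
  by rewrite -(card_rcoset X y0) subset_leq_card // mulgS ?sub1set.
Qed.

Lemma mem_prod_sets (Xs : seq {set gT}) z :
  z \in \prod_(X <- Xs) X ->
  exists2 xs, all2 (fun x X => x \in X) xs Xs & \prod_(x <- xs) x = z.
Proof.
elim: Xs z => [|X Xs IHXs] z; first by rewrite big_nil => /set1P->; exists [::]; rewrite ?big_nil.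
rewrite big_cons => /mulsgP[x u Xx /IHXs[xs Hxs <-] ->].
by exists (x :: xs); rewrite /= ?Xx ?big_cons.
Qed.

Lemma cauchy_davenport_seq (Xs : seq {set gT}) :
    prime #|A| -> all (fun X => (X \subset A) && (X != set0)) Xs ->
    #|A| <= (\sum_(X <- Xs) #|X|.-1).+1 ->
  \prod_(X <- Xs) X = A.
Proof.
move=> prA allXs leA.
(* Invariant of the induction: either the product already fills [A], or every factor has contributed
   its size less one. *)
suff [sPA P0 leP] : [/\ \prod_(X <- Xs) X \subset A, \prod_(X <- Xs) X != set0
    & (#|A| <= #|\prod_(X <- Xs) X|) || (\sum_(X <- Xs) #|X|.-1 < #|\prod_(X <- Xs) X|)].
  by apply/eqP; rewrite eqEcard sPA /=; case/orP: leP => // /(leq_trans leA).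
elim: Xs allXs {leA} => [|X Xs IHXs] /=.
  rewrite !big_nil cards1 orbT sub1G => _; split=> //.
  by apply/set0Pn; exists 1; rewrite inE.
case/andP=> /andP[sXA X0] /IHXs[sPA P0 leP]; rewrite !big_cons; split.
- by rewrite mul_subG.
- have [x Xx] := set0Pn _ X0; have [z Pz] := set0Pn _ P0.
  by apply/set0Pn; exists (x * z); rewrite mem_mulg.
- have [x Xx] := set0Pn _ X0; have [z Pz] := set0Pn _ P0.
  have leXP : #|X| <= #|X * \prod_(X <- Xs) X|.
    by rewrite -(card_rcoset X z) subset_leq_card // mulgS ?sub1set.
  have lePP : #|\prod_(X <- Xs) X| <= #|X * \prod_(X <- Xs) X|.
    by rewrite -(card_lcoset _ x) subset_leq_card // mulSg ?sub1set.
  have X_gt0 : 0 < #|X| by rewrite card_gt0.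
  move: (cauchy_davenport prA sXA sPA X0 P0) leP leXP lePP X_gt0.
  move: #|_| #|_| #|_| #|_| (\sum_(_ <- _) _) => a b c d e; lia.
Qed.

End SetProducts.

(** * Weighted Erdos-Ginzburg-Ziv theorems *)

(** A pair [(a, i)] stands for the term [a] conjugated by [x ^+ i], which multiplies its exponent
    [v a] by [r ^ i]. *)
Definition wsum (T : Type) (r : nat) (v : T -> nat) (ps : seq (T * nat)) : nat :=
  (\sum_(z <- ps) r ^ z.2 * v z.1)%N.

(** For [r = 1] this is the classical Erdos-Ginzburg-Ziv property. The type of terms is arbitrary,
    so that whole selections can again serve as terms. *)
Definition weighted_EGZ (r n L : nat) : Prop :=
  forall (T : eqType) (v : T -> nat) (s : seq T), L <= size s ->
  exists ps s2, [/\ perm_eq s (map fst ps ++ s2), size ps = n & n %| wsum r v ps].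

Lemma wsum_cat (T : Type) r (v : T -> nat) ps1 ps2 :
  wsum r v (ps1 ++ ps2) = (wsum r v ps1 + wsum r v ps2)%N.
Proof. exact: big_cat. Qed.

Lemma weighted_EGZ_iter r n L (T : eqType) (v : T -> nat) k (s : seq T) :
    weighted_EGZ r n L -> k.-1 * n + L <= size s \/ k = 0%N ->
  exists gs s2, [/\ perm_eq s (map fst (flatten gs) ++ s2), size gs = k
    & all (fun ps => (size ps == n) && (n %| wsum r v ps)) gs].
Proof.
move=> Q; elim: k s => [|k IHk] s; first by exists [::], s; rewrite perm_refl.
case=> // /= les; have [|ps [s2 [Es szps dvps]]] := Q T v s; first lia.
have szs : size s = (n + size s2)%N by rewrite (perm_size Es) size_cat size_map szps.
have [|gs [s3 [Es2 szgs allgs]]] := IHk s2; first by case: k {IHk} les => [|k] /=; [right | left; nia].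
exists (ps :: gs), s3; split; rewrite /= ?szgs ?szps ?eqxx ?dvps //.
by rewrite map_cat -catA (perm_trans Es) // perm_cat2l.
Qed.

(** Extract [La] selections of [b] terms with sum divisible by [b], then apply the statement for [a]
    to these sums divided by [b]. *)
Lemma weighted_EGZ_mul r a b La Lb :
    0 < a -> 0 < b -> 0 < La ->
    weighted_EGZ r a La -> weighted_EGZ r b Lb ->
  weighted_EGZ r (a * b) (La.-1 * b + Lb).
Proof.
move=> a0 b0 La0 Qa Qb T v s les.
have [|gs [s2 [Es szgs allgs]]] := weighted_EGZ_iter (k := La) v Qb (s := s); first by left.
have [|qs [gs2 [Egs szqs dvqs]]] := Qa (seq (T * nat)) (fun ps => wsum r v ps %/ b) gs; first by rewrite szgs.
(* Multiplying the sum of a selection by [r ^ j] amounts to adding [j] to each of its exponents. *)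
pose twist (q : seq (T * nat) * nat) := [seq (z.1, q.2 + z.2)%N | z <- q.1].
exists (flatten (map twist qs)), (map fst (flatten gs2) ++ s2).
have allqs : all (fun q => (size q.1 == b) && (b %| wsum r v q.1)) qs.
  by move: allgs; rewrite (perm_all _ Egs) all_cat all_map => /andP[].
have twistE q : map fst (twist q) = map fst q.1 by rewrite -map_comp.
split.
- apply: perm_trans Es _; rewrite catA perm_cat2r.
  have -> : map fst (flatten [seq twist i | i <- qs]) = map fst (flatten (map fst qs)).
    by rewrite !map_flatten -!map_comp; congr flatten; apply: eq_map => q; apply: twistE.
  by rewrite -map_cat -flatten_cat perm_map ?perm_flatten.
- rewrite -szqs; elim: qs allqs {Egs szqs dvqs} => //= q qs IH /andP[/andP[/eqP szq _] /IH].
  by rewrite size_cat => ->; rewrite size_map szq mulSn.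
- have -> : wsum r v (flatten (map twist qs)) = (wsum r (fun ps => wsum r v ps %/ b) qs * b)%N.
    elim: qs allqs {Egs szqs dvqs} => [|q qs IH] /=; first by rewrite /wsum !big_nil.
    case/andP=> /andP[_ dvq] /IH {}IH; rewrite wsum_cat IH [in RHS]/wsum big_cons mulnDl -mulnA divnK //.
    congr (_ + _)%N; rewrite /wsum big_map big_distrr /=; apply: eq_bigr => z _ /=.
    by rewrite expnD mulnA.
  by rewrite dvdn_pmul2r.
Qed.

Lemma weighted_EGZ_weak r n L L' : L <= L' -> weighted_EGZ r n L -> weighted_EGZ r n L'.
Proof. by move=> leL Q T v s /(leq_trans leL); apply: Q. Qed.

Lemma weighted_EGZ1 r : weighted_EGZ r 1 1.
Proof.
by move=> T v [|z s] // _; exists [:: (z, 0%N)], s; rewrite dvd1n perm_refl.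
Qed.

Ltac perm_lia E :=
  let Q := fresh "Q" in apply/seq.permP=> Q; move/seq.permP: E => /(_ Q); do 3!rewrite /= ?count_cat; clear; lia.

(** * Cauchy-Davenport modulo a prime, through gadgets *)

Section PrimeModulus.
Variables (q r : nat) (T : eqType) (v : T -> nat).
Hypothesis pr_q : prime q.

Local Notation res ps := ((wsum r v ps)%:R : 'F_q)%R.

(** A gadget is a list of alternative selections. This is its contribution to the Cauchy-Davenport
    bound, where only distinct residues count. *)
Definition gadget_size (C : seq (seq (T * nat))) := #|[set z in [seq res ps | ps <- C]]|.-1.

Lemma weighted_gadgets (Cs : seq (seq (seq (T * nat)))) :
    all (fun C => C != [::]) Cs -> q <= (\sum_(C <- Cs) gadget_size C).+1 ->
  exists2 cs, all2 (fun c C => c \in C) cs Cs & q %| wsum r v (flatten cs).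
Proof.
move=> nzCs leq_q.
pose X (C : seq (seq (T * nat))) := [set z in [seq res ps | ps <- C]].
have dv0 n : (n%:R == 0 :> 'F_q)%R = (q %| n) by rewrite -(dvdn_pcharf (pchar_Fp pr_q)).
have XA : (\prod_(A <- map X Cs) A = [set: 'F_q]%G)%g.
  apply: cauchy_davenport_seq => /=.
  - exact: FinRing.zmod_abelian.
  - by rewrite cardsT card_Fp.
  - apply/allP=> _ /mapP[C CsC ->]; rewrite subsetT /=.
    have := allP nzCs C CsC; case: C {CsC} => // c C _.
    by apply/set0Pn; exists (res c); rewrite inE /= inE eqxx.
  - by rewrite big_map cardsT card_Fp.
have /mem_prod_sets[xs all_xs sum0] : (1%g \in \prod_(A <- map X Cs) A)%g by rewrite XA inE.
have [cs all_cs sum_cs] : exists2 cs, all2 (fun c C => c \in C) cs Cs & res (flatten cs) = (\prod_(x <- xs) x)%g.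
  elim: Cs xs all_xs {nzCs leq_q XA sum0} => [|C Cs IH] [|x xs] //=.
    by exists [::]; rewrite // big_nil /wsum big_nil.
  case/andP; rewrite inE => /mapP[c Cc ->] /IH[cs all_cs Ecs].
  by exists (c :: cs); rewrite /= ?Cc // big_cons wsum_cat natrD Ecs FinRing.zmodMgE.
by exists cs; rewrite // -dv0 sum_cs sum0.
Qed.

Lemma gadget_size_uniq C : uniq [seq res ps | ps <- C] -> gadget_size C = (size C).-1.
Proof. by move=> uC; rewrite /gadget_size cardsE (card_uniqP uC) size_map. Qed.

End PrimeModulus.

Lemma wsum1 (T : Type) r (v : T -> nat) x i : wsum r v [:: (x, i)] = r ^ i * v x.
Proof. by rewrite /wsum big_seq1. Qed.

Lemma all2_flatten_singles (T : eqType) (C : T -> seq (seq (T * nat))) (s : seq T) cs :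
    (forall x c, c \in C x -> map fst c = [:: x]) ->
  all2 (fun c D => c \in D) cs (map C s) -> map fst (flatten cs) = s.
Proof.
move=> CE; elim: s cs => [|x s IH] [|c cs] //= /andP[/CE Ec /IH Es].
by rewrite map_cat Ec Es.
Qed.

Lemma all2_split (A B : Type) (R : A -> B -> bool) xs ys zs :
  all2 R xs (ys ++ zs) -> exists xs1 xs2, [/\ xs = xs1 ++ xs2, all2 R xs1 ys & all2 R xs2 zs].
Proof.
elim: ys xs => [|y ys IH] xs /=; first by exists [::], xs.
case: xs => //= x xs /andP[Rxy /IH[xs1 [xs2 [-> R1 R2]]]].
by exists (x :: xs1), xs2; rewrite /= Rxy.
Qed.

(* Each pair [(a, b)] of incongruent terms offers a choice between [a] and [b]. *)
Lemma all2_flatten_pairs (T : eqType) (s t : seq T) cs : size s = size t ->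
    all2 (fun c C => c \in C) cs [seq [:: [:: (z.1, 0)]; [:: (z.2, 0)]] | z <- zip s t] ->
  size (flatten cs) = size s /\ exists u, perm_eq (s ++ t) (map fst (flatten cs) ++ u).
Proof.
elim: s t cs => [|a s IH] [|b t] [|c cs] //=; first by move=> _ _; split=> //; exists [::].
case=> /IH{}IH /andP[+ /IH[szcs [u Eu]]]; rewrite !inE => /orP[] /eqP-> /=; rewrite szcs; split=> //.
  by exists (b :: u); perm_lia Eu.
by exists (a :: u); perm_lia Eu.
Qed.

(** Sort the terms by residue and compare the terms at distance [q - 1]. *)
Lemma EGZ_prime q : prime q -> weighted_EGZ 1 q (2 * q).-1.
Proof.
move=> pr_q T v s0 les0; have q1 := prime_gt1 pr_q.
pose leT := [rel a b | v a %% q <= v b %% q].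
have leT_tr : transitive leT by move=> a b c; apply: leq_trans.
have leT_tot : total leT by move=> a b; apply: leq_total.
pose s := sort leT s0; have Es : perm_eq s0 s by rewrite perm_sym perm_sort.
have szs : (2 * q).-1 <= size s by rewrite size_sort.
have srt : sorted leT s by apply: sort_sorted.
case Ds: s => [|x0 s'] in szs; first by move: szs => /=; lia.
rewrite -{s'}Ds in szs.
(* Equal residues at both ends of a sorted window of [q] terms make the whole window constant, and
   its sum is divisible by [q]. *)
have [/existsP[i /eqP vi] | ] := boolP [exists i : 'I_q.-1, v (nth x0 s i) %% q == v (nth x0 s (i + q.-1)) %% q].
  pose w := take q (drop i s); have szw : size w = q by rewrite size_takel // size_drop; have := ltn_ord i; lia.
  exists [seq (x, 0) | x <- w], (take i s ++ drop q (drop i s)); split.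
  - rewrite -map_comp map_id (perm_trans Es) // -{1}(cat_take_drop i s) -{1}(cat_take_drop q (drop i s)).
    by rewrite perm_catCA.
  - by rewrite size_map.
  - rewrite /wsum big_map /dvdn.
    have vw x : x \in w -> v x %% q = v (nth x0 s i) %% q.
      case/(nthP x0)=> j; rewrite szw => ltj <-; rewrite nth_take // nth_drop.
      have ltiq := ltn_ord i.
      have le_nth a b : a <= b -> b < size s -> v (nth x0 s a) %% q <= v (nth x0 s b) %% q.
        move=> leab ltb; apply: (sorted_leq_nth leT_tr _ x0 srt) => //; rewrite ?inE //; first by move=> a'; apply: leqnn.
        exact: leq_ltn_trans ltb.
      by apply/eqP; rewrite eqn_leq {1}vi !le_nth //; lia.
    rewrite (eq_bigr (fun x => v x)); last by move=> x _; rewrite expn0 mul1n.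
    rewrite -modn_summ (eq_big_seq (fun=> v (nth x0 s i) %% q)) //.
    by rewrite big_const_seq count_predT szw iter_addn_0 modnMl.
rewrite negb_exists => /forallP neq.
(* Now the [q - 1] pairs at distance [q - 1] are incongruent: each is a gadget of size 1, and the
   next term [x] is always taken to reach [q] terms. *)
pose a := take q.-1 s; pose b := take q.-1 (drop q.-1 s); pose l := drop (q.-1 + q.-1) s.
have sza : size a = q.-1 by rewrite size_takel //; lia.
have szb : size b = q.-1 by rewrite size_takel // size_drop; lia.
have Dl : exists x l', l = x :: l'.
  have : 0 < size l by rewrite size_drop; lia.
  by case: l => // x l' _; exists x, l'.
case: Dl => x [l' Dl].
pose Cs := [seq [:: [:: (z.1, 0)]; [:: (z.2, 0)]] | z <- zip a b] ++ [:: [:: [:: (x, 0)]]].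
have [||cs] := @weighted_gadgets q 1 T v pr_q Cs.
- by rewrite all_cat all_map /= andbT; apply/allP.
- rewrite big_cat /= big_map.
  rewrite (eq_big_seq (fun=> 1)); last first.
    move=> z /(nthP (x0, x0))[j]; rewrite size_zip sza szb minnn => ltj <-.
    rewrite nth_zip ?sza ?szb //= gadget_size_uniq //= !inE andbT !wsum1 !expn0 !mul1n.
    rewrite !nth_take // nth_drop addnC.
    have := neq (Ordinal ltj); apply: contraNN => /eqP/(congr1 val) /=.
    by rewrite !val_Fp_nat // => ->.
  by rewrite sum1_size size_zip sza szb minnn; lia.
move=> /all2_split[cs1 [[|c cs2] [-> /all2_flatten_pairs[]]]]; rewrite ?sza ?szb //=.
move=> szcs1 [u Eu]; rewrite inE => /andP[/eqP-> ]; case: cs2 => // _ dvq.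
exists (flatten cs1 ++ [:: (x, 0)]), (u ++ l'); split.
- apply: perm_trans Es _; rewrite -(cat_take_drop (q.-1 + q.-1) s) -/l Dl takeD -/a -/b.
  by rewrite map_cat; perm_lia Eu.
- by rewrite size_cat szcs1 addn1 prednK ?prime_gt0.
- by move: dvq; rewrite flatten_cat.
Qed.

(** * Weights that are powers of an element of order [p] modulo [q] *)

Section PrimeOrbits.
Variables (p q r : nat).
Hypotheses (pr_p : prime p) (pr_q : prime q) (r1 : r <> 1 %[mod q]) (rp : r ^ p = 1 %[mod q]).

Lemma prim_root_r : (p.-primitive_root (r%:R : 'F_q))%R.
Proof.
have natE i : (r%:R ^+ i = (r ^ i)%:R :> 'F_q)%R by rewrite natrX.
have modE i : ((r ^ i)%:R == 1 :> 'F_q)%R = (r ^ i == 1 %[mod q]).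
  apply/eqP/eqP => [/(congr1 val) | E]; first by rewrite /= val_Fp_nat // => ->; rewrite [RHS]modn_small ?prime_gt1.
  by rewrite -(Fp_nat_mod pr_q) E Fp_nat_mod.
have [|k prim_k] := @prim_order_exists _ p (r%:R : 'F_q)%R (prime_gt0 pr_p).
  by apply/eqP; rewrite natE modE; apply/eqP.
case/primeP: pr_p => _ dvp /dvp /orP[] /eqP Ek; last by rewrite -Ek.
case: r1; apply/eqP; rewrite -[r]expn1 -modE -natE -(prim_order_dvd prim_k).
by rewrite Ek.
Qed.

(** By Fermat [r ^ (q - 1)] is [1] modulo [q], and [r] has order [p] there. *)
Lemma dvd_pred_q : p %| q.-1.
Proof.
rewrite (prim_order_dvd prim_root_r); have q0 := prime_gt0 pr_q.
have r0 : (r%:R != 0 :> 'F_q)%R.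
  apply: contra_eq_neq (prim_expr_order prim_root_r) => ->.
  by rewrite expr0n eqn0Ngt prime_gt0 // eq_sym oner_neq0.
have := expf_card (r%:R : 'F_q)%R; rewrite card_Fp // => /eqP.
have -> : ((r%:R : 'F_q) ^+ q = r%:R * r%:R ^+ q.-1)%R by rewrite -exprS prednK.
by rewrite -subr_eq0 -[X in (_ - X)%R]mulr1 -mulrBr mulf_eq0 (negPf r0) subr_eq0.
Qed.

Lemma orbit_uniq (T : eqType) (v : T -> nat) x : ~~ (q %| v x) ->
  uniq [seq ((wsum r v [:: (x, i)])%:R : 'F_q)%R | i <- iota 0 p].
Proof.
move=> ndv; rewrite map_inj_in_uniq ?iota_uniq // => i j.
rewrite !mem_iota !wsum1 !natrM !natrX => ltip ltjp /mulIf.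
rewrite (dvdn_pcharf (pchar_Fp pr_q)) in ndv => /(_ ndv)/eqP.
by rewrite (eq_prim_root_expr prim_root_r) !modn_small //; [move/eqP | lia..].
Qed.

(* The [k < q] items divisible by [q] are fillers.  Of the others, [q - k] are
   forced into the selection, each offering the [p] elements of its orbit, and
   up to [k] are optional, each offering its orbit and [0]. *)
Lemma weighted_EGZ_prime : weighted_EGZ r q (q + q.-1 %/ p).
Proof.
move=> T v s0 les0; have q1 := prime_gt1 pr_q; have p1 := prime_gt1 pr_p.
have /divnK := dvd_pred_q; set t := q.-1 %/ p in les0 * => tE.
pose Z := [seq x <- s0 | q %| v x]; pose Y := [seq x <- s0 | ~~ (q %| v x)].
have Es : perm_eq s0 (Z ++ Y) by rewrite perm_sym perm_filterC.
have szs : size s0 = size Z + size Y by rewrite (perm_size Es) size_cat.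
have dvZ W : {subset W <= Z} -> q %| wsum r v [seq (x, 0) | x <- W].
  move=> sWZ; rewrite /wsum big_map big_seq dvdn_sum // => x /sWZ.
  by rewrite mem_filter => /andP[dv _]; rewrite dvdn_mull.
have [leqZ | ltZq] := leqP q (size Z).
  exists [seq (x, 0) | x <- take q Z], (drop q Z ++ Y); split.
  - by rewrite -map_comp map_id catA cat_take_drop.
  - by rewrite size_map size_takel.
  - by apply: dvZ => x; apply: mem_take.
pose k := size Z; pose o := minn k t; pose f := q - k.
pose F := take f Y; pose O := take o (drop f Y); pose Y' := drop o (drop f Y).
have EY : Y = F ++ O ++ Y' by rewrite !cat_take_drop.
have szF : size F = f by rewrite size_takel // /f /k; move: szs les0; clear; lia.
have szO : size O = o.
  by rewrite size_takel // size_drop /o /f /k; move: szs les0 ltZq; clear; lia.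
have ndY x : x \in Y -> ~~ (q %| v x) by rewrite mem_filter => /andP[].
have ndF x : x \in F -> ~~ (q %| v x) by move=> Fx; rewrite ndY // EY mem_cat Fx.
have ndO x : x \in O -> ~~ (q %| v x) by move=> Ox; rewrite ndY // EY !mem_cat Ox orbT.
pose orb (x : T) := [seq [:: (x, i)] | i <- iota 0 p].
have [||cs] := @weighted_gadgets q r T v pr_q (map orb F ++ map (fun x => [::] :: orb x) O).
- rewrite all_cat !all_map; apply/andP; split; apply/allP=> // x _ /=.
  by rewrite -size_eq0 size_map size_iota; lia.
- have szF' x : x \in F -> gadget_size q r v (orb x) = p.-1.
    move=> Fx; rewrite gadget_size_uniq -?map_comp ?orbit_uniq ?ndF //.
    by rewrite size_map size_iota.
  have szO' x : x \in O -> gadget_size q r v ([::] :: orb x) = p.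
    move=> Ox; rewrite gadget_size_uniq /= -?map_comp ?orbit_uniq ?ndO //.
      by rewrite size_map size_iota.
    rewrite andbT; apply/mapP=> -[i _]; rewrite /= wsum1 /wsum big_nil natrM natrX.
    move/esym/eqP; rewrite /= mulf_eq0 expf_eq0 -[X in _ || X](dvdn_pcharf (pchar_Fp pr_q)) (negPf (ndO x Ox)) orbF.
    case/andP=> _ /eqP r0; have := prim_expr_order prim_root_r.
    by rewrite r0 expr0n eqn0Ngt prime_gt0 // => /esym/eqP; rewrite oner_eq0.
  rewrite big_cat !big_map /= (eq_big_seq (fun=> p.-1)) // [X in _ + X](eq_big_seq (fun=> p)) //.
  rewrite !big_const_seq !count_predT !iter_addn_0 szF szO /o /f.
  have leF : q - k <= p.-1 * (q - k) by rewrite leq_pmull // -subn1 subn_gt0.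
  have leO : k <= p * k by rewrite leq_pmull // ltnW.
  (* If [o = t], the optional gadgets alone give [p * t = q - 1]. If [o = k], the forced ones give
     at least [q - k] and the optional ones at least [k]. *)
  rewrite mulnC in tE; rewrite /minn; case: ltnP => _; last by rewrite tE -addnS prednK ?leq_addl // ltnW.
  by move: ltZq leF leO; rewrite -/k; clear; lia.
case/all2_split=> csF [csO [-> allF allO]]; rewrite flatten_cat => dvq.
have EF : map fst (flatten csF) = F.
  by apply: all2_flatten_singles allF => x c /mapP[i _ ->].
have [szcO [u Eu]] : size (flatten csO) <= size O /\
    exists u, perm_eq O (map fst (flatten csO) ++ u).
  elim: {ndO szO EY} O csO allO {dvq} => [|x O' IH] [|c cs'] //=; first by split=> //; exists [::].
  case/andP=> Cc /IH[szcs [u Eu]]; move: Cc; rewrite inE => /orP[/eqP-> | /mapP[i _ ->]] /=.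
    split; first exact: leqW.
    by exists (x :: u); perm_lia Eu.
  by split=> //; exists u; rewrite perm_cons.
(* Fillers replace the optional items left out, which brings the total back to [q]. *)
pose z := k - size (flatten csO).
exists (flatten csF ++ flatten csO ++ [seq (x, 0) | x <- take z Z]), (drop z Z ++ u ++ Y'); split.
- apply: perm_trans Es _; rewrite EY -{1}(cat_take_drop z Z) !map_cat EF -map_comp map_id.
  by perm_lia Eu.
- have := congr1 size EF; rewrite !size_cat !size_map size_takel ?leq_subr // szF => ->.
  by rewrite /z subnKC ?subnK ?(ltnW ltZq) // (leq_trans szcO) // szO geq_minl.
- rewrite catA wsum_cat dvdn_add // dvZ // => x; exact: mem_take.
Qed.

End PrimeOrbits.

(** Induction on [m], splitting off a prime [q]: the bound reproduces itself, as [(2 * q - 2) * m' +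
    (2 * m' - 1) = 2 * q * m' - 1]. *)
Lemma EGZ m : 0 < m -> weighted_EGZ 1 m (2 * m).-1.
Proof.
have [n] := ubnP m; elim: n m => // n IHn m lemn m0.
have [/eqP-> | m1] := boolP (m == 1); first exact: weighted_EGZ1.
have /pdiv_prime pr_q : 1 < m by rewrite ltn_neqAle eq_sym m1.
have [m' Em] := dvdnP (pdiv_dvd m); set q := pdiv m in pr_q Em.
have q1 := prime_gt1 pr_q; have m'0 : 0 < m' by case: m' Em m0 => // ->.
have Qm' : weighted_EGZ 1 m' (2 * m').-1 by apply: IHn => //; move: Em lemn q1 m'0; clear; nia.
rewrite Em mulnC; apply: weighted_EGZ_weak (weighted_EGZ_mul _ _ _ (EGZ_prime pr_q) Qm').
- by move: q1 m'0; clear; nia.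
- exact: ltnW.
- by [].
- by move: q1; clear; lia.
Qed.

(** The same induction. Since [m - 1 = (q - 1) * m' + (m' - 1)], both the divisibility by [p] and
    the bound pass from [q] and [m'] to [m]. *)
Lemma orbit_EGZ p r m : prime p -> 0 < m -> r ^ p = 1 %[mod m] ->
    (forall q, prime q -> q %| m -> r <> 1 %[mod q]) ->
  p %| m.-1 /\ weighted_EGZ r m (m + m.-1 %/ p).
Proof.
move=> pr_p; have [n] := ubnP m; elim: n m => // n IHn m lemn m0 rp r1.
have [/eqP-> | m1] := boolP (m == 1).
  by rewrite dvdn0 div0n; split=> //; apply: weighted_EGZ1.
have /pdiv_prime pr_q : 1 < m by rewrite ltn_neqAle eq_sym m1.
have [m' Em] := dvdnP (pdiv_dvd m); set q := pdiv m in pr_q Em.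
have q1 := prime_gt1 pr_q; have m'0 : 0 < m' by case: m' Em m0 => // ->.
have rpm d : d %| m -> r ^ p = 1 %[mod d] by move=> dvd; rewrite -(modn_dvdm _ dvd) rp modn_dvdm.
have dvq : q %| m := pdiv_dvd m; have dvm' : m' %| m by rewrite Em dvdn_mulr.
have [|||| dvp Qm'] := IHn m'; rewrite ?rpm //; first by move: Em lemn q1 m'0; clear; nia.
  by move=> l pr_l dvl; apply: r1 => //; apply: dvdn_trans dvm'.
have dvq1 := dvd_pred_q pr_p pr_q (r1 q pr_q dvq) (rpm q dvq).
have Qq := weighted_EGZ_prime pr_p pr_q (r1 q pr_q dvq) (rpm q dvq).
have p0 := prime_gt0 pr_p; have /dvdnP[a Ea] := dvp; have /dvdnP[b Eb] := dvq1.
have Em1 : m.-1 = (b * m' + a) * p.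
  by rewrite mulnDl -Ea mulnAC -Eb Em; move: q1 m'0; clear; nia.
rewrite Em1 dvdn_mull // mulnK //; split=> //; rewrite {1}Em mulnC.
rewrite Ea mulnK // Eb mulnK // in Qm' Qq *.
apply: weighted_EGZ_weak (weighted_EGZ_mul (ltnW q1) m'0 _ Qq Qm').
  by rewrite Em; move: q1 m'0; clear; nia.
by rewrite addn_gt0 ltnW.
Qed.

(** * From weighted sums of exponents to products in cyclic groups *)

Section CyclicGroups.
Local Open Scope group_scope.
Variable gT : finGroupType.

Lemma cyclic_log (c : gT) : exists l : gT -> nat, forall z, z \in <[c]> -> z = c ^+ l z.
Proof.
exists (fun z => if [pick i : 'I_#[c] | z == c ^+ i] is Some i then val i else 0%N) => z.
case/cyclePmin=> i lti Ez; case: pickP => [j /eqP // | /(_ (Ordinal lti))].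
by rewrite Ez eqxx.
Qed.

Lemma EGZ_cyclic (H : {group gT}) (T : eqType) (f : T -> gT) k (s : seq T) :
    cyclic H -> (forall z, z \in s -> f z \in H) -> (k * #|H| + #|H|.-1 <= size s)%N ->
  exists s1 s2, [/\ perm_eq s (s1 ++ s2), size s1 = (k * #|H|)%N & \prod_(z <- s1) f z = 1].
Proof.
case/cyclicP=> c EH Hs les; have [l lE] := cyclic_log c.
have [| gs [s2 [Es szgs allgs]]] := weighted_EGZ_iter (k := k) (fun z => l (f z)) (EGZ (cardG_gt0 H)) (s := s).
  case: k les => [|k] les; [by right | left => /=].
  by apply: leq_trans les; have := cardG_gt0 H; move: #|H|; clear; nia.
exists (map fst (flatten gs)), s2; split=> //.
  rewrite size_map -szgs; elim: gs allgs {Es szgs} => //= g gs IH /andP[/andP[/eqP szg _] /IH].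
  by rewrite size_cat szg => ->.
have sgs z : z \in map fst (flatten gs) -> f z \in H.
  by move=> gz; apply: Hs; rewrite (perm_mem Es) mem_cat gz.
elim: gs allgs {Es szgs} sgs => [|g gs IH] /=; first by rewrite big_nil.
case/andP=> /andP[_ dvg] allgs; rewrite map_cat => sgs.
rewrite big_cat /= IH ?mulg1 //; last by move=> z gz; rewrite sgs // mem_cat gz orbT.
have -> : \prod_(z <- map fst g) f z = c ^+ wsum 1 (fun z => l (f z)) g.
  elim: g {dvg} sgs => [|z g IHg] sgs; first by rewrite /wsum !big_nil.
  rewrite /= big_cons IHg => [|u gu]; last by rewrite sgs //= inE gu orbT.
  rewrite {1}(lE (f z.1)) -?EH ?sgs //=; last by rewrite inE eqxx.
  by rewrite -expgD /wsum big_cons exp1n mul1n.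
by apply/eqP; rewrite -order_dvdn /order -EH.
Qed.

(** Conjugation by [x] multiplies exponents of [y] by [r], so a weighted sum divisible by [#[y]] is
    a product of conjugates equal to [1]. *)
Lemma orbit_EGZ_cyclic (x y : gT) p r (T : eqType) (f : T -> gT) (s : seq T) :
    prime p -> y ^ x = y ^+ r -> r ^ p = 1 %[mod #[y]] ->
    (forall q, prime q -> q %| #[y] -> r <> 1 %[mod q]) ->
    (forall z, z \in s -> f z \in <[y]>) -> (#[y] + #[y].-1 %/ p <= size s)%N ->
  exists ps s2, [/\ perm_eq s (map fst ps ++ s2), size ps = #[y]
    & \prod_(z <- ps) f z.1 ^ (x ^+ z.2) = 1].
Proof.
move=> pr_p yx rp r1 Ns les; have [_ Q] := orbit_EGZ pr_p (order_gt0 y) rp r1.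
have [l lE] := cyclic_log y.
have [ps [s2 [Es szps dvps]]] := Q T (fun z => l (f z)) s les.
exists ps, s2; split=> //.
have sps z : z \in map fst ps -> f z \in <[y]>.
  by move=> gz; apply: Ns; rewrite (perm_mem Es) mem_cat gz.
have yxi i : y ^ (x ^+ i) = y ^+ (r ^ i).
  elim: i => [|i IHi]; first by rewrite conjg1.
  by rewrite expgSr conjgM IHi conjXg yx -expgM expnS.
have -> : \prod_(z <- ps) f z.1 ^ (x ^+ z.2) = y ^+ wsum r (fun z => l (f z)) ps.
  elim: ps {dvps Es szps} sps => [|z g IHg] sgs; first by rewrite /wsum !big_nil.
  rewrite big_cons IHg => [|u gu]; last by rewrite sgs //= inE gu orbT.
  rewrite {1}(lE (f z.1)) ?sgs //=; last by rewrite inE eqxx.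
  by rewrite conjXg yxi -expgM -expgD /wsum big_cons.
by apply/eqP; rewrite -order_dvdn.
Qed.

End CyclicGroups.

(** * Product-one subsequences and rotations *)

Local Open Scope group_scope.

Lemma group_prod_seq (gT : finGroupType) (G : {group gT}) (T : eqType) (f : T -> gT) (s : seq T) :
  (forall z, z \in s -> f z \in G) -> \prod_(z <- s) f z \in G.
Proof. by move=> Gs; rewrite big_seq group_prod. Qed.

Section Davenport.
Variables (gT : finGroupType) (G N : {group gT}).
Hypotheses (nNG : N <| G) (abN : abelian N).
Hypothesis freeN : forall g c, g \in G -> g \notin N -> c \in N -> c ^ g = c -> c = 1.
Variables (T : eqType) (f : T -> gT).
Implicit Types s : seq T.
Local Notation prd s := (\prod_(z <- s) f z).

(** A shortest nonempty segment of [s] with product in [N] works: none of its shorter segments has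
    product in [N]. *)
Lemma minimal_segment s :
    (forall z, z \in s -> f z \in G) -> (#|G : N| <= size s)%N ->
  exists s1 u s2, [/\ s = s1 ++ u ++ s2, u != [::], prd u \in N
    & forall i j, (i < j < size u)%N -> prd (take (j - i) (drop i u)) \notin N].
Proof.
move=> Gs les.
pose P n := (0 < n)%N && [exists i : 'I_(size s).+1, (i + n <= size s)%N && (prd (take n (drop i s)) \in N)].
(* Pigeonhole: among the [#|G : N| + 1] shortest prefixes, the empty one included, two lie in the
   same coset of [N]. *)
have exP : exists n, P n.
  pose F (i : 'I_(#|G : N|).+1) := N :* prd (take i s).
  have Gt i : prd (take i s) \in G by apply: group_prod_seq => z /mem_take/Gs.
  have /injectivePn[i [j neq_ij EF]] : ~~ injectiveb F.
    apply/negP=> /injectiveP injF.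
    have: (#|[set F i | i in 'I_(#|G : N|).+1]| <= #|G : N|)%N.
      apply: subset_leq_card; apply/subsetP=> _ /imsetP[i _ ->].
      by apply/rcosetsP; exists (prd (take i s)).
    by rewrite card_imset // card_ord ltnn.
  wlog lt_ij : i j neq_ij EF / (i < j)%N.
    move=> IH; case: (ltngtP i j) => [|lt_ji|/val_inj Eij]; first exact: IH neq_ij EF.
      by apply: IH lt_ji; rewrite // eq_sym.
    by rewrite Eij eqxx in neq_ij.
  have ltj : (j <= size s)%N by apply: leq_trans les; rewrite -ltnS.
  exists (j - i)%N; rewrite /P subn_gt0 lt_ij; apply/existsP.
  have lti : (i < (size s).+1)%N by apply: leq_trans lt_ij (leqW ltj).
  exists (Ordinal lti); rewrite /= subnKC ?(ltnW lt_ij) // ltj /=.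
  have Ej : prd (take j s) = prd (take i s) * prd (take (j - i) (drop i s)).
    by rewrite -big_cat -takeD subnKC // ltnW.
  have : prd (take j s) * (prd (take i s))^-1 \in N.
    by rewrite -mem_rcoset -[N :* _]/(F i) EF rcoset_refl.
  rewrite Ej -{1}[prd (take i s)]invgK -mulgA -conjgE memJ_norm //.
  by rewrite groupV (subsetP (normal_norm nNG)).
case: (ex_minnP exP) => n /andP[n0 /existsP[i /andP[lein Nn]]] minn.
pose u := take n (drop i s).
have szu : size u = n by rewrite size_takel // size_drop leq_subRL // -ltnS.
exists (take i s), u, (drop n (drop i s)); split=> //.
- by rewrite !cat_take_drop.
- by rewrite -size_eq0 szu -lt0n.
move=> a b /andP[lt_ab]; rewrite szu => lt_bn; apply/negP=> Nab.
have /minn : P (b - a)%N; last by rewrite leqNgt (leq_ltn_trans (leq_subr _ _)).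
have ltia : (i + a < (size s).+1)%N.
  by rewrite ltnS (leq_trans _ lein) // leq_add2l ltnW // (ltn_trans lt_ab).
rewrite /P subn_gt0 lt_ab; apply/existsP; exists (Ordinal ltia).
rewrite /= -addnA subnKC ?(ltnW lt_ab) // (leq_trans _ lein) /=; last by rewrite leq_add2l ltnW.
have <- : take (b - a) (drop a u) = take (b - a) (drop (i + a) s); last by [].
by rewrite /u -[n](subnK (leq_trans (ltnW lt_ab) (ltnW lt_bn))) -take_drop drop_drop addnC take_takel ?leq_sub2r // ltnW.
Qed.

(* A minimal segment [u] with product in [N] either has product [1], or its
   rotations have [size u] distinct products, since [G \ N] acts freely. *)
Lemma rotation_products s :
    (forall z, z \in s -> f z \in G) -> (#|G : N| <= size s)%N ->
  exists u s', [/\ perm_eq s (u ++ s'), u != [::]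
    & prd u = 1 \/ exists A : {set gT}, [/\ A \subset N, 1 \notin A, #|A| = size u
        & forall z, z \in A -> exists2 t, perm_eq t u & prd t = z]].
Proof.
move=> Gs /(minimal_segment Gs)[s1 [u [s2 [Es u0 Nu min_u]]]].
exists u, (s1 ++ s2); split=> //; first by rewrite Es perm_catCA.
have [-> | c1] := eqVneq (prd u) 1; first by left.
right; pose F (i : 'I_(size u)) := prd u ^ prd (take i u).
have Gu z : z \in u -> f z \in G by move=> uz; apply: Gs; rewrite Es !mem_cat uz orbT.
have Gt i : prd (take i u) \in G by apply: group_prod_seq => z /mem_take/Gu.
have NF i : F i \in N by rewrite memJ_norm // (subsetP (normal_norm nNG)).
have F1 i : F i != 1 by rewrite conjg_eq1.
exists [set F i | i in 'I_(size u)]; split.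
- by apply/subsetP=> _ /imsetP[i _ ->].
- by apply/imsetP=> -[i _ /esym/eqP]; rewrite (negPf (F1 i)).
- rewrite card_in_imset ?card_ord // => i j _ _.
  wlog lt_ij : i j / (i < j)%N.
    move=> IH EF; case: (ltngtP i j) => [|lt_ji|/val_inj//]; first by move/IH; apply.
    by apply/esym/(IH _ _ lt_ji).
  move=> EF; have lt_ju := ltn_ord j.
  have nNQ := min_u i j; rewrite lt_ij lt_ju in nNQ.
  case/eqP: (F1 i); apply: freeN (nNQ isT) (NF i) _.
    by apply: group_prod_seq => z /mem_take/mem_drop/Gu.
  by rewrite /F -conjgM -big_cat -takeD subnKC 1?ltnW // -[RHS]EF.
- move=> _ /imsetP[i _ ->]; exists (rot i u); first by rewrite perm_rot.
  have Eu : prd u = prd (take i u) * prd (drop i u) by rewrite -big_cat cat_take_drop.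
  by rewrite /F conjgE Eu /rot big_cat -!mulgA mulKg.
Qed.

(** Strong induction on [n]: split off a segment [u], whose rotations together with [1] form a set
    of size [size u + 1]. Scherk's inequality then adds [size u] to the number of products obtained
    from the remaining terms. *)
Lemma davenport_sets n s :
    (forall z, z \in s -> f z \in G) -> (n == 0) || (n + #|G : N| <= (size s).+1)%N ->
  (exists t r, [/\ perm_eq s (t ++ r), t != [::] & prd t = 1]) \/
  (exists X : {set gT}, [/\ X \subset N, 1 \in X, (n < #|X|)%N
     & forall z, z \in X -> exists t r, perm_eq s (t ++ r) /\ prd t = z]).
Proof.
have [k] := ubnP n; elim: k n s => // k IHk [|n] s lenk Gs /= les.
  right; exists [set 1]; rewrite sub1G set11 cards1; split=> // z /set1P->.
  by exists [::], s; rewrite big_nil perm_refl.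
have [|u [s' [Es u0 Au]]] := rotation_products Gs; first by move: les; move: #|_ : _| (size s); clear; lia.
case: Au => [u1 | [A [sAN nA1 cA Au]]]; first by left; exists u, s'.
have szs : size s = (size u + size s')%N by rewrite (perm_size Es) size_cat.
have Gs' z : z \in s' -> f z \in G by move=> s'z; apply: Gs; rewrite (perm_mem Es) mem_cat s'z orbT.
have u_gt0 : (0 < size u)%N by rewrite lt0n size_eq0.
have [||[t [r [Es' t0 t1]]] | [X [sXN X1 cX XE]]] := IHk (n.+1 - size u)%N s' _ Gs'.
- by move: lenk u_gt0; clear; lia.
- by move: les; rewrite szs; move: #|_ : _|; clear; lia.
- left; exists t, (u ++ r); split=> //.
  by rewrite (perm_trans Es) // perm_sym perm_catCA perm_cat2l perm_sym.
have comb a x : a \in 1 |: A -> x \in X ->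
    exists t r, [/\ perm_eq s (t ++ r), prd t = a * x & a != 1 -> t != [::]].
  move=> Aa /XE[t [r [Es' <-]]]; case/setU1P: Aa => [-> | /Au[v Ev <-]].
    exists t, (u ++ r); rewrite mul1g eqxx; split=> //.
    by rewrite (perm_trans Es) // perm_sym perm_catCA perm_cat2l perm_sym.
  exists (v ++ t), r; rewrite big_cat; split=> // [|_].
    rewrite (perm_trans Es) // -catA (perm_trans (_ : perm_eq _ (u ++ (t ++ r)))) ?perm_cat2l //.
    by rewrite perm_cat2r perm_sym.
  by rewrite -size_eq0 size_cat (perm_size Ev) addn_eq0 size_eq0 (negPf u0).
(* A factorization [a * x = 1] with [x != 1] has [a != 1], so it spells a nonempty product-one
   subsequence; without one, Scherk's inequality applies. *)
have [/exists_inP[a Aa /exists_inP[x Xx /andP[/eqP ax1 x1]]] | nax] :=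
    boolP [exists a in 1 |: A, [exists x in X, (a * x == 1) && (x != 1)]].
  have [t [r [Es2 Et t0]]] := comb a x Aa Xx.
  left; exists t, r; split=> //; last by rewrite Et.
  by apply: t0; apply: contraNneq x1 => a1; rewrite -ax1 a1 mul1g.
right; exists ((1 |: A) * X); split.
- by rewrite mul_subG // subUset sub1G.
- by have := mem_mulg (setU11 1 A) X1; rewrite mulg1.
- have := @scherk _ N abN (1 |: A) X; rewrite subUset sub1G sAN setU11 cardsU1 nA1 cA => /(_ isT sXN isT X1).
  move=> Hs; apply: leq_trans (_ : (n.+2 <= (1 + size u + #|X|).-1)%N) _.
    by move: cX u_gt0; move: #|_|; clear; lia.
  rewrite -ltnS (leq_trans (leqSpred _)) //; last first.
    apply: Hs => a x Aa Xx ax1; apply/eqP; apply: contraNT nax => x1.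
    by apply/exists_inP; exists a => //; apply/exists_inP; exists x; rewrite // ax1 eqxx.
- move=> _ /mulsgP[a x Aa Xx ->]; have [t [r [Es2 Et _]]] := comb a x Aa Xx.
  by exists t, r.
Qed.

Lemma davenport s :
    (forall z, z \in s -> f z \in G) -> (#|N| + #|G : N| <= (size s).+1)%N ->
  exists t r, [/\ perm_eq s (t ++ r), t != [::] & prd t = 1].
Proof.
move=> Gs les; have [|//|[X [sXN _ cX _]]] := @davenport_sets #|N| s Gs.
  by rewrite les orbT.
by have := subset_leq_card sXN; rewrite leqNgt cX.
Qed.

End Davenport.

(** * Subproducts and twisting *)

Section Toggles.
Variables (gT : finGroupType) (H : {group gT}).
Hypothesis abH : abelian H.
Implicit Types s t : seq gT.

Definition subprods s := \prod_(c <- s) [set 1; c].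

Lemma subprods_cons c s : subprods (c :: s) = [set 1; c] * subprods s.
Proof. exact: big_cons. Qed.

Lemma subprodsP s z : z \in subprods s ->
  exists t r, perm_eq s (t ++ r) /\ \prod_(c <- t) c = z.
Proof.
elim: s z => [|c s IH] z; first by rewrite /subprods big_nil => /set1P->; exists [::], [::]; rewrite big_nil.
rewrite subprods_cons => /mulsgP[e u ce /IH[t [r [Es <-]]] ->].
case/set2P: ce => ->; last by exists (c :: t), r; rewrite big_cons perm_cons.
by exists t, (c :: r); rewrite mul1g perm_sym -cat1s perm_catCA perm_cons perm_sym.
Qed.

Lemma subprods_sub s : {subset s <= H} -> subprods s \subset H.
Proof.
elim: s => [|c s IH] Hs; first by rewrite /subprods big_nil sub1G.
rewrite subprods_cons mul_subG //.
  by rewrite subUset !sub1set group1 Hs ?mem_head.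
by apply: IH => z sz; rewrite Hs // inE sz orbT.
Qed.

Lemma subprods1 s : 1 \in subprods s.
Proof.
elim: s => [|c s IH]; first by rewrite /subprods big_nil set11.
by rewrite subprods_cons -[1 in X in X \in _]mulg1 mem_mulg // set21.
Qed.

Lemma subset_toggle c (X : {set gT}) : X \subset [set 1; c] * X.
Proof. by rewrite -{1}[X]mul1g mulSg // sub1set set21. Qed.

(* Multiplying [X * K] by [1, c] with [c] outside [K] adds at least one coset of
   [K]: otherwise [c] would stabilize [X * K] and hence the full set of
   subproducts, whose stabilizer is [K]. *)
Lemma subprods_full s : {subset s <= H} ->
    (forall K : {group gT}, K \proper H -> (#|H : K| <= (count (fun c => c \notin K) s).+1)%N) ->
  subprods s = H.
Proof.
move=> Hs ltH; set X := subprods s; have sXH : X \subset H := subprods_sub Hs.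
pose KS := [set z in H | X :* z == X].
have grKS : group_set KS.
  apply/group_setP; split=> [|a b]; first by rewrite inE group1 rcoset1 /=.
  rewrite !inE => /andP[Ha /eqP Xa] /andP[Hb /eqP Xb].
  by rewrite groupM //= rcosetM Xa Xb.
pose K := Group grKS; have sKH : K \subset H by apply/subsetP=> z; rewrite inE => /andP[].
have XK : X * K = X.
  apply/eqP; rewrite eqEsubset -{3}[X]mulg1 mulgS ?sub1G // andbT.
  apply/subsetP=> _ /mulsgP[a z Xa /setIdP[_ /eqP <-] ->].
  by rewrite mem_rcoset mulgK.
have grow s1 s2 : s = s1 ++ s2 ->
    (#|K| * (count (fun c => c \notin K) s2).+1 <= #|(subprods s2 * K)%g|)%N.
  elim: s2 s1 => [|c s2 IH] s1 Es; first by rewrite muln1 /subprods big_nil mul1g.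
  have {IH} := IH (rcons s1 c); rewrite cat_rcons => /(_ Es) IH.
  have Hc : c \in H by rewrite Hs // Es mem_cat inE eqxx orbT.
  have sH2 : subprods s2 \subset H by apply: subprods_sub => z s2z; rewrite Hs // Es mem_cat inE s2z !orbT.
  rewrite subprods_cons -mulgA /=; set X2 := subprods s2 * K in IH *.
  have sX2H : X2 \subset H by rewrite mul_subG.
  have [Kc | nKc] /= := boolP (c \in K).
    by apply: leq_trans IH _; rewrite subset_leq_card ?subset_toggle.
  have [sub2 | /subsetPn[w]] := boolP (c *: X2 \subset X2).
    case/negP: nKc; rewrite inE Hc /=.
    have X2c : X2 :* c = X2.
      apply/eqP; rewrite eqEcard card_rcoset leqnn andbT.
      apply: subset_trans sub2; apply/subsetP=> _ /rcosetP[u X2u ->].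
      by rewrite (centsP abH u (subsetP sX2H _ X2u) c Hc) mem_lcoset mulKg.
    have XE : X = subprods s1 * [set 1; c] * X2.
      by rewrite -{1}XK /X Es /subprods big_cat /= big_cons !mulgA.
    by rewrite XE -[_ :* c]mulgA X2c.
  case/lcosetP=> u X2u Ew nX2w.
  have disj : [disjoint X2 & w *: K].
    rewrite disjoint_subset; apply/subsetP=> v X2v; apply: contra nX2w; rewrite mem_lcoset => Kwv.
    have -> : w = v * (w^-1 * v)^-1 by rewrite invMg invgK mulKVg.
    by rewrite -[X2]/(subprods s2 * K) -(mulGid K) mulgA mem_mulg ?groupV.
  rewrite mulnS addnC; apply: leq_trans (_ : #|X2 :|: w *: K| <= _)%N.
    by rewrite cardsU disjoint_setI0 // cards0 subn0 card_lcoset leq_add2r.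
  rewrite subset_leq_card // subUset subset_toggle /=.
  apply/subsetP=> _ /lcosetP[k Kk ->]; rewrite Ew -mulgA mem_mulg ?set22 //.
  by rewrite /X2 -(mulGid K) mulgA mem_mulg.
have := grow [::] s (erefl _); rewrite -/X XK => leX.
apply/eqP; rewrite eqEcard sXH /=.
(* If [K = H], then [X] is stable under [H] and contains [1], so it is [H]. Otherwise the hypothesis
   on [K] yields [#|H : K|] cosets. *)
have [EKH | ltKH] := eqVproper sKH.
  by rewrite -XK EKH -{1}(card_lcoset H 1) subset_leq_card // mulSg // sub1set subprods1.
by rewrite -(Lagrange sKH) (leq_trans _ leX) // leq_mul2l ltH ?orbT.
Qed.

(** Keep only the terms that enlarge the set of subproducts; it starts with one element and each
    kept term adds at least one more. *)
Lemma irredundant_subprods s : exists t r,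
  [/\ perm_eq s (t ++ r), subprods t = subprods s & (size t < #|subprods t|)%N].
Proof.
elim: s => [|c s [t [r [Es Et lt_t]]]].
  by exists [::], [::]; rewrite /subprods big_nil cards1.
have [Ec | nc] := eqVneq ([set 1; c] * subprods t) (subprods t).
  exists t, (c :: r); rewrite subprods_cons -Et Ec; split=> //.
  by rewrite perm_sym -cat1s perm_catCA perm_cons perm_sym.
exists (c :: t), r; rewrite !subprods_cons Et perm_cons; split=> //=.
by apply: leq_ltn_trans lt_t _; rewrite -Et proper_card // properEneq eq_sym nc subset_toggle.
Qed.

Lemma toggle_basis s : {subset s <= H} ->
    (forall K : {group gT}, K \proper H -> (#|H : K| <= (count (fun c => c \notin K) s).+1)%N) ->
  exists t r, [/\ perm_eq s (t ++ r), (size t < #|H|)%N & subprods t = H].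
Proof.
move=> Hs /(subprods_full Hs) EX; have [t [r [Es Et lt_t]]] := irredundant_subprods s.
by exists t, r; rewrite Et EX in lt_t *.
Qed.

End Toggles.

Lemma prod_perm_abelian (gT : finGroupType) (H : {group gT}) (T : eqType) (f : T -> gT) (s t : seq T) :
    abelian H -> (forall z, z \in s -> f z \in H) -> perm_eq s t ->
  \prod_(z <- s) f z = \prod_(z <- t) f z.
Proof.
move=> abH; elim: s t => [|c s IH] t Hs Est; first by have := perm_size Est; case: t {Est}.
have tc : c \in t by rewrite -(perm_mem Est) mem_head.
case/splitPr: tc Est => t1 t2 Est.
have Es : perm_eq s (t1 ++ t2) by rewrite -(perm_cons c) (perm_trans Est) // -cat1s perm_catCA.
have Hs' z : z \in s -> f z \in H by move=> sz; rewrite Hs // inE sz orbT.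
rewrite big_cons (IH _ Hs' Es) !big_cat big_cons /= !mulgA; congr (_ * _).
apply: (centsP abH); first by rewrite Hs ?mem_head.
by apply: group_prod_seq => z t1z; rewrite Hs' // (perm_mem Es) mem_cat t1z.
Qed.

(** * Commutators with elements outside [N] *)

Section Twist.
Variables (gT : finGroupType) (G N H : {group gT}).
Hypotheses (nNG : N <| G) (abN : abelian N) (sHN : H \subset N) (nHG : H <| G).
Hypothesis freeN : forall g c, g \in G -> g \notin N -> c \in N -> c ^ g = c -> c = 1.

(** An injective map of the finite set [H] to itself is onto; if [h] and [k] have the same image,
    then [g] fixes [k * h^-1], which is therefore [1]. *)
Lemma commutator_surj g z : g \in G -> g \notin N -> z \in H ->
  exists2 h, h \in H & h^-1 * h ^ g = z.
Proof.
move=> Gg nNg Hz; pose phi h := h^-1 * h ^ g.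
have Hg h : h \in H -> h ^ g \in H by move=> Hh; rewrite memJ_norm // (subsetP (normal_norm nHG)).
suff /setP Ephi : phi @: H = H.
  by have := Hz; rewrite -{1}Ephi => /imsetP[h Hh ->]; exists h.
apply/eqP; rewrite eqEcard card_in_imset ?leqnn ?andbT.
  by apply/subsetP=> _ /imsetP[h Hh ->]; rewrite groupM ?groupV ?Hg.
move=> h k Hh Hk; rewrite /phi => E.
have /(canRL (mulgK _)) : k * h^-1 = 1; last by rewrite mul1g invgK => ->.
apply: (freeN Gg nNg); first by rewrite (subsetP sHN) // groupM ?groupV.
have -> : (k * h^-1) ^ g = k * (k^-1 * k ^ g) * (h ^ g)^-1 by rewrite conjMg conjVg mulKVg.
by rewrite -E (mulgA k) mulgK.
Qed.

(** The Davenport bound in [G / H], where the action stays free: if [c^-1 * c ^ g] lies in [H], it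
    equals [h^-1 * h ^ g] for some [h] in [H], so [g] fixes [c * h^-1] and [c = h]. *)
Lemma davenport_mod (s : seq gT) :
    {subset s <= G} -> (#|N : H| + #|G : N| <= (size s).+1)%N ->
  exists t r, [/\ perm_eq s (t ++ r), t != [::] & \prod_(z <- t) z \in H].
Proof.
move=> Gs les; have nHs : G \subset 'N(H) := normal_norm nHG.
have nHN : N \subset 'N(H) := subset_trans (normal_sub nNG) nHs.
have [|||||t [r [Es t0 t1]]] := @davenport _ (G / H)%G (N / H)%G _ _ _ _ (coset H) s.
- exact: quotient_normal.
- exact: quotient_abelian.
- move=> _ _ /morphimP[g nHg Gg ->] nNg /morphimP[c nHc Nc ->].
  rewrite -morphJ // => /(rcoset_kercosetP (groupJ nHc nHg) nHc) Ecg.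
  have nNg' : g \notin N by apply: contra nNg => Ng; rewrite mem_morphim.
  have [h Hh Eh] : exists2 h, h \in H & h^-1 * h ^ g = c^-1 * c ^ g.
    apply: commutator_surj => //; move: Ecg => /rcosetP[k Hk ->].
    have Nk := subsetP sHN k Hk.
    by rewrite (centsP abN k Nk c Nc) mulKg.
  suff -> : c = h by apply: coset_id.
  have Nh := subsetP sHN h Hh.
  apply/eqP; rewrite eq_mulgV1; apply/eqP; apply: freeN Gg nNg' _ _.
    by rewrite groupM ?groupV.
  have -> : (c * h^-1) ^ g = c * (c^-1 * c ^ g) * (h ^ g)^-1 by rewrite conjMg conjVg mulKVg.
  by rewrite -Eh (mulgA c) mulgK.
- by move=> z sz; rewrite mem_quotient ?Gs.
- by rewrite card_quotient // (index_quotient_eq (subset_trans (subsetIr G H) sHN) (normal_sub nNG) nHs).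
exists t, r; split=> //; have nHt z : z \in t -> z \in 'N(H).
  by move=> tz; rewrite (subsetP nHs) // Gs // (perm_mem Es) mem_cat tz.
apply: coset_idr; first by rewrite big_seq group_prod.
by rewrite -t1 big_seq morph_prod //= [RHS]big_seq.
Qed.

(* Moving a factor [c] of [N] across [g] outside [N] changes the product by
   a conjugate of [c^-1 * c ^ g], so the subproducts of [t] give all of [H]. *)
Lemma twisted_product_one (w t h : seq gT) :
    {subset w <= G} -> \prod_(z <- w) z \in H -> has (fun g => g \notin N) w ->
    {subset t <= H} -> subprods t = H -> {subset h <= H} ->
  exists2 u, perm_eq u (w ++ t ++ h) & \prod_(z <- u) z = 1.
Proof.
move=> Gw Hw /hasP[g wg nNg] Ht Et Hh.
have Gg := Gw g wg; have nHg := subsetP (normal_norm nHG) g Gg.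
case/splitPr: wg Gw Hw => w1 w2 Gw Hw.
have Gw1 : \prod_(z <- w1) z \in G.
  by apply: group_prod_seq => z w1z; rewrite Gw // mem_cat w1z.
pose p (s : seq gT) := \prod_(z <- s) z.
have Hg : g * p (w2 ++ w1) \in H.
  have -> : g * p (w2 ++ w1) = p (w1 ++ g :: w2) ^ p w1.
    by rewrite /p !big_cat big_cons /= conjgE !mulgA mulVg mul1g.
  by rewrite memJ_norm // (subsetP (normal_norm nHG)).
have Hpt : p t \in H by apply: group_prod_seq.
have Hph : p h \in H by apply: group_prod_seq.
(* The factors of product [e] will stand before [g] and the rest of [t] after it; [e] is chosen so
   that its commutator with [g] cancels the product of everything else. *)
have Hq : (p t * p h * (g * p (w2 ++ w1)) ^ g)^-1 \in H by rewrite groupV groupM ?memJ_norm // groupM.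
have [e He Ee] := commutator_surj Gg nNg Hq.
have /subprodsP[t1 [t2 [Et12 Et1]]] : e \in subprods t by rewrite Et.
exists (t1 ++ g :: t2 ++ h ++ w2 ++ w1).
  by rewrite perm_sym; perm_lia Et12.
have abH a b : a \in H -> b \in H -> a * b = b * a.
  by move=> Ha Hb; apply: (centsP abN); apply: (subsetP sHN).
have Ht2 : p t2 \in H.
  by apply: group_prod_seq => z t2z; rewrite Ht // (perm_mem Et12) mem_cat t2z orbT.
have Ept : p t = e * p t2.
  by rewrite -Et1 -big_cat; apply: (prod_perm_abelian (f := id) (abelianS sHN abN)).
have Kg : (g * p (w2 ++ w1)) ^ g = p (w2 ++ w1) * g by rewrite conjgE !mulgA mulVg mul1g.
rewrite Kg in Hq Ee; set k := p (w2 ++ w1) in Hg Hq Kg Ee.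
have Hk : k * g \in H by rewrite -Kg memJ_norm.
have -> : \prod_(z <- t1 ++ g :: t2 ++ h ++ w2 ++ w1) z = e * g * (p t2 * p h * k).
  by rewrite !big_cat big_cons !big_cat Et1 /k /p big_cat /= !mulgA.
have -> : e * g = g * (e * (p t * p h * (k * g))^-1) by rewrite -Ee mulKVg conjgE mulKVg.
have Ek : p t2 * p h * k = e^-1 * (p t * p h) * k by rewrite Ept !mulgA mulVg mul1g.
have Hv : (p t * p h * (k * g))^-1 \in H by rewrite groupV groupM // groupM.
rewrite (abH e _ He Hv) Ek; set v := p t * p h in Hv *.
by rewrite -(mulgA e^-1) -(mulgA g) -(mulgA _ e) mulKVg (mulgA v) invMg -mulgA mulVg mulg1 mulgV.
Qed.

End Twist.

(** * Few terms outside the kernel *)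

Lemma EGZ_count (gT : finGroupType) (H : {group gT}) k (s : seq gT) :
    cyclic H -> (k * #|H| + #|H|.-1 <= count (mem H) s)%N ->
  exists t r, [/\ perm_eq s (t ++ r), size t = (k * #|H|)%N & \prod_(z <- t) z = 1].
Proof.
move=> cycH; rewrite -size_filter => les.
have [|t [r [Es szt t1]]] := EGZ_cyclic (H := H) (f := id) (k := k) cycH _ les.
  by move=> z; rewrite mem_filter => /andP[].
exists t, (r ++ [seq z <- s | z \notin H]); split=> //.
have := permEl (perm_filterC (mem H) s); rewrite perm_sym => /perm_trans; apply.
by rewrite catA perm_cat2r.
Qed.

(** Here [d] and [h] are the index and the order of [H] in [N], and [s], [w], [n1] count the terms
    in [H], in [N] outside [H], and outside [N]. The key fact is [(2 * d - 1) * (h - 1) >= 0]. *)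
Lemma few_outside_arith p m d h w n1 s : 1 < p -> p < m -> (d * h)%N = m ->
    (w < d)%N -> (n1 < m + p.-1 * p.-1)%N -> (s + w + n1)%N = (p * m + m + p - 2)%N ->
  (d + p + h <= s + 3)%N.
Proof.
move=> p1 ltpm Em ltw ltn1 Es.
have le1 : (2 * d + h <= 2 * m + 1)%N.
  have : (0 < d)%N by case: d ltw {Em}.
  have : (0 < h)%N by case: h Em ltpm => //; rewrite muln0 => <-.
  by rewrite -Em; case: d {ltw Em Es} => // d; case: h => // h _ _; clear; nia.
case: p p1 ltpm ltn1 Es => // -[|p] //= _ ltpm ltn1 Es.
have : (p * (p + 3) <= p * m)%N by rewrite leq_mul2l; apply/orP; right; move: ltpm; clear; lia.
by move: ltn1 Es le1 ltw; clear; nia.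
Qed.

Lemma heavy_arith p m d h w n1 s : (d * h)%N = m -> (1 < h)%N ->
    (w + 2 <= d)%N -> (n1 + 2 <= d + p)%N -> (s + w + n1)%N = (p * m + m + p - 2)%N ->
  (p * m + h.-1 <= s)%N.
Proof.
move=> Em h1 lew len1 Es.
have : (2 * d + h <= m + 2)%N.
  by rewrite -Em; case: h h1 {Em} => // -[|h] // _; case: d lew {Es len1} => [|[|d]]; clear; nia.
by move: h1 lew len1 Es; move: (p * m)%N; clear; lia.
Qed.

Section FewOutside.
Variables (gT : finGroupType) (G N : {group gT}) (p : nat).
Hypotheses (nNG : N <| G) (cycN : cyclic N) (p_gt1 : (1 < p)%N) (iGN : #|G : N| = p).
Hypothesis freeN : forall g c, g \in G -> g \notin N -> c \in N -> c ^ g = c -> c = 1.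
Local Notation m := #|N|.

Lemma subcyclic_normal (H : {group gT}) : H \subset N -> H <| G.
Proof. by move=> sHN; apply: char_normal_trans nNG; rewrite sub_cyclic_char. Qed.

(** Append to [w] pieces with product in [H], each of at most [D - 1] terms, until the size reaches
    [lo]. The last piece is added at size at most [lo - 1], whence the bound [lo + D - 2]. *)
Lemma grow_product (H : {group gT}) lo (w q : seq gT) (D := (#|N : H| + p)%N) :
    H \subset N -> {subset w ++ q <= G} -> \prod_(z <- w) z \in H ->
    (lo <= size w)%N || (lo + D <= size w + size q + 2)%N ->
  exists e r, [/\ perm_eq q (e ++ r), \prod_(z <- w ++ e) z \in H, (lo <= size (w ++ e))%N
    & (size (w ++ e) <= maxn (size w) (lo + D - 2))%N].
Proof.
move=> sHN; have [n] := ubnP (size q); elim: n w q => // n IHn w q leqn Gwq Hw les.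
have [lew | ltw] := leqP lo (size w).
  by exists [::], q; rewrite cats0 leq_maxl.
rewrite leqNgt ltw /= in les.
have D_gt1 : (1 < D)%N by rewrite /D; move: p_gt1; clear; lia.
have szq : (D.-1 <= size q)%N by move: les ltw; clear -D_gt1; lia.
have Gq : {subset q <= G} by move=> z qz; rewrite Gwq // mem_cat qz orbT.
have [||t [r [Eq t0 Ht]]] := davenport_mod nNG (cyclic_abelian cycN) sHN (subcyclic_normal sHN) freeN (s := take D.-1 q).
- by move=> z /mem_take/Gq.
- by rewrite size_takel // iGN -/D prednK // ltnW.
have Eq' : perm_eq q (t ++ r ++ drop D.-1 q) by rewrite -{1}(cat_take_drop D.-1 q) catA perm_cat2r.
have szt : (size t <= D.-1)%N.
  by have := perm_size Eq; rewrite size_takel // size_cat => ->; apply: leq_addr.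
have t_gt0 : (0 < size t)%N by rewrite lt0n size_eq0.
have szq' : size q = (size t + size (r ++ drop D.-1 q))%N by rewrite (perm_size Eq') size_cat.
set q' := r ++ _ in Eq' szq'.
have [||||e [r' [Eq2 Hwe lo_we we_hi]]] := IHn (w ++ t) q'.
- by rewrite -ltnS (leq_trans _ leqn) // ltnS szq' -[X in (X < _)%N]add0n ltn_add2r.
- by move=> z; rewrite -catA mem_cat -(perm_mem Eq') -mem_cat; apply: Gwq.
- by rewrite big_cat groupM.
- by apply/orP; right; rewrite size_cat -(addnA (size w)) -szq'.
exists (t ++ e), r'; rewrite catA; split=> //.
  by rewrite (perm_trans Eq') // -catA perm_cat2l.
apply: leq_trans we_hi _; rewrite !geq_max; apply/andP; split; apply/leq_trans/leq_maxr => //.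
have arith a b : (a <= D.-1 -> b < lo -> b + a <= lo + D - 2)%N by move: D_gt1; clear; lia.
by rewrite size_cat arith.
Qed.

Lemma product_one_few_outside (s : seq gT) :
    {subset s <= G} -> size s = (p * m + m + p - 2)%N -> (p < m)%N ->
    (count (fun z => z \notin N) s < m + p.-1 * p.-1)%N ->
  exists t r, [/\ perm_eq s (t ++ r), size t = (p * m)%N & \prod_(z <- t) z = 1].
Proof.
move=> Gs szs ltpm ltn1; set n1 := count _ s in ltn1.
have abN := cyclic_abelian cycN.
(* With fewer than [p] terms outside [N], at least [p * m + m - 1] lie in the cyclic group [N],
   where Erdos-Ginzburg-Ziv suffices. *)
have [ltn1p | lepn1] := ltnP n1 p.
  apply: EGZ_count => //; have := count_predC (mem N) s.
  rewrite -[count (predC _) s]/n1 szs; move: ltn1p p_gt1 ltpm; clear; lia.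
pose w (H : {set gT}) := count (fun z => (z \in N) && (z \notin H)) s.
pose P (H : {group gT}) := (H \subset N) && ((H == N) || (w H + 2 <= #|N : H|)%N).
have PN : P N by rewrite /P subxx eqxx.
have [H /mingroupP[/andP[sHN PH] minH] _] := mingroup_exists PN.
pose d := #|N : H|; pose h := #|H|; pose hs := [seq z <- s | z \in H].
have Em : (d * h)%N = m by rewrite mulnC Lagrange.
have d_gt0 : (0 < d)%N by apply: indexg_gt0.
have h_gt0 : (0 < h)%N by apply: cardG_gt0.
have wN : w N = 0%N by apply/eqP; rewrite -leqn0 leqNgt -has_count; apply/hasPn=> z _; rewrite andbN.
have lewd : (w H < d)%N.
  case/orP: PH => [/eqP EH | ]; last by rewrite -/d; clear; lia.
  by rewrite EH wN.
have szhs : (size hs + w H + n1 = size s)%N.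
  rewrite size_filter /w /n1 -(count_predC (mem N) s); congr (_ + _)%N.
  rewrite -count_predUI -[RHS]addn0; congr (_ + _)%N.
    apply: eq_count => z /=; case: (boolP (z \in H)) => [/(subsetP sHN)-> //|_] /=.
    by rewrite andbT.
  by apply/eqP; rewrite -leqn0 leqNgt -has_count; apply/hasPn=> z _ /=; case: (z \in H); rewrite ?andbF.
have leh : (d + p + h <= size hs + 3)%N.
  by apply: few_outside_arith p_gt1 ltpm Em lewd ltn1 _; rewrite szhs szs.
have sub_hs : {subset hs <= H} by move=> z; rewrite mem_filter => /andP[].
have [|y [r [Ehs szy Ey]]] := toggle_basis (abelianS sHN abN) sub_hs.
  (* By minimality [P K] fails, so many terms of [N] lie outside [K]; as few of them lie outside
     [H], the others belong to [H]. *)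
  move=> K /properP[sKH [z Hz nKz]]; have sKN := subset_trans sKH sHN.
  have nPK : ~~ P K.
    by apply/negP=> PK; move: nKz; have -> := minH K PK sKH; rewrite Hz.
  have EK : (w K = w H + count (fun c => c \notin K) hs)%N.
    rewrite count_filter /w -count_predUI -[LHS]addn0; congr (_ + _)%N.
      apply: eq_count => c /=; have /implyP := subsetP sKH c; have /implyP := subsetP sHN c.
      by case: (c \in N); case: (c \in H); case: (c \in K).
    apply/esym/eqP; rewrite -leqn0 leqNgt -has_count; apply/hasPn=> c _ /=.
    by case: (c \in H); rewrite ?andbF.
  move: nPK; rewrite /P sKN /= negb_or -ltnNge -(Lagrange_index sHN sKH) -/d EK => /andP[_].
  have : (0 < #|H : K|)%N by apply: indexg_gt0.
  case/orP: PH => [/eqP EH | ]; last by rewrite -/d; move: d_gt0; move: #|_ : _| (count _ _); clear; nia.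
  rewrite EH wN /d EH indexgg mul1n.
  by move: #|_ : _| (count _ _); clear; lia.
pose nh := [seq z <- s | z \notin H].
have Es : perm_eq s (hs ++ nh) by rewrite perm_sym perm_filterC.
have sznh : (size hs + size nh = size s)%N by rewrite (perm_size Es) size_cat.
have Gnh : {subset nh <= G} by move=> z; rewrite mem_filter => /andP[_]; apply: Gs.
(* If [H] is nontrivial and too few terms lie outside [N] to build a starting piece from them alone,
   then [H] has enough terms for Erdos-Ginzburg-Ziv. *)
have [/andP[h_gt1 ltn1d] | start] := boolP ((1 < h) && (n1 + 2 <= d + p))%N.
  have [|t [r' [Et szt t1]]] := EGZ_count (H := H) (k := (d * p)%N) (s := s) (cyclicS sHN cycN).
    rewrite -size_filter -/hs -/h mulnAC Em mulnC.
    have EHN : H :=: N -> False.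
      by move=> EH; move: ltn1d; rewrite /d EH indexgg; move: lepn1; clear; lia.
    apply: (heavy_arith (w := w H) (s := size hs) Em h_gt1 _ ltn1d); last by rewrite szhs szs.
    by case/orP: PH => // /eqP/(congr1 val)/EHN.
  by exists t, r'; rewrite szt -/h mulnAC Em mulnC.
have [w0 [q0 [Enh Hw0 szw0 out_w0]]] : exists w0 q0, [/\ perm_eq nh (w0 ++ q0),
    \prod_(z <- w0) z \in H, (size w0 <= (d + p).-1)%N & h = 1%N \/ has (fun z => z \notin N) w0].
  have [h1 | h_neq1] := eqVneq h 1%N.
    by exists [::], nh; rewrite big_nil group1; split=> //; left.
  pose s1 := [seq z <- nh | z \notin N].
  have szs1 : size s1 = n1.
    rewrite !size_filter /nh count_filter; apply: eq_count => z /=.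
    by apply: andb_idr; apply: contra; apply: (subsetP sHN).
  have les1 : ((d + p).-1 <= size s1)%N.
    move: start; rewrite szs1 negb_and -leqNgt -ltnNge.
    by move: h_neq1 h_gt0; clear; lia.
  have [||t [r' [Et t0 Ht]]] := davenport_mod nNG abN sHN (subcyclic_normal sHN) freeN (s := take (d + p).-1 s1).
  - by move=> z /mem_take; rewrite mem_filter => /andP[_]; apply: Gnh.
  - by rewrite size_takel // iGN -/d prednK // addn_gt0 d_gt0.
  have Es1 : perm_eq s1 (t ++ r' ++ drop (d + p).-1 s1) by rewrite -{1}(cat_take_drop (d + p).-1 s1) catA perm_cat2r.
  exists t, (r' ++ drop (d + p).-1 s1 ++ [seq z <- nh | ~~ (z \notin N)]); split=> //.
  - have := permEl (perm_filterC (fun z => z \notin N) nh); rewrite perm_sym => /perm_trans; apply.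
    by rewrite !catA perm_cat2r -catA.
  - by have := perm_size Et; rewrite size_takel // size_cat => ->; apply: leq_addr.
  - right; case: t t0 Es1 {Et Ht} => // z t _ Es1; apply/hasP; exists z; first exact: mem_head.
    have : z \in s1 by rewrite (perm_mem Es1) mem_head.
    by rewrite mem_filter => /andP[].
(* At least this many terms must come from outside [H]. *)
pose lo := (p * m - size hs)%N.
have dh_m : (d + h <= m + 1)%N.
  have aux a b : (0 < a -> 0 < b -> a + b <= a * b + 1)%N by clear; case: a b => // a [] // b _ _; nia.
  by rewrite -Em aux.
have [||e [r' [Eq0 Hwe lo_we we_hi]]] := grow_product (lo := lo) sHN _ Hw0 (q := q0).
- by move=> z; rewrite -(perm_mem Enh); apply: Gnh.
- have := perm_size Enh; rewrite size_cat -/d /lo => <-.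
  have aux a b : (a + b = p * m + m + p - 2 -> (p * m - a <= size w0) || (p * m - a + (d + p) <= b + 2))%N.
    by move: dh_m h_gt0 p_gt1; move: (p * m)%N (size w0); clear; lia.
  by apply: aux; rewrite sznh szs.
set w1 := w0 ++ e in Hwe lo_we we_hi.
(* Room is left for the toggles [y], which number at most [h - 1]. *)
have szw1 : (size w1 + h <= p * m + 1)%N.
  apply: leq_trans (_ : maxn (size w0) (lo + (d + p) - 2) + h <= _)%N; first by rewrite leq_add2r.
  rewrite addn_maxl geq_max /lo; move: szw0 leh dh_m d_gt0 h_gt0 p_gt1 ltpm; clear.
  by move=> *; apply/andP; split; nia.
pose k := (p * m - size w1 - size y)%N.
have szr : (size y + size r = size hs)%N by rewrite (perm_size Ehs) size_cat.
have szk : (size w1 + size y + k = p * m)%N.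
  by rewrite /k; move: szw1 szy; rewrite -/h; clear; lia.
have lek : (k <= size r)%N.
  have aux a b c a1 a2 : (a1 + a2 = a -> c - a <= b -> c - b - a1 <= a2)%N by clear; lia.
  exact: aux szr lo_we.
have Gw1 : {subset w1 <= G}.
  move=> z; rewrite mem_cat => w1z; apply: Gnh; rewrite (perm_mem Enh) mem_cat (perm_mem Eq0) mem_cat.
  by case/orP: w1z => ->; rewrite ?orbT.
have sub_y : {subset y <= H} by move=> z yz; rewrite sub_hs // (perm_mem Ehs) mem_cat yz.
have sub_r : {subset take k r <= H}.
  by move=> z /mem_take rz; rewrite sub_hs // (perm_mem Ehs) mem_cat rz orbT.
have [u Eu u1] : exists2 u, perm_eq u (w1 ++ y ++ take k r) & \prod_(z <- u) z = 1.
  case: out_w0 => [h1 | out]; last first.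
    by apply: (twisted_product_one abN sHN (subcyclic_normal sHN) freeN); rewrite ?has_cat ?out.
  exists (w1 ++ y ++ take k r) => //; apply/set1gP; rewrite -(card1_trivg h1).
  by rewrite big_cat groupM // big_cat groupM //; apply: group_prod_seq.
exists u, (drop k r ++ r'); split=> //.
  apply: perm_trans Es _; rewrite -(perm_cat2r (drop k r ++ r')) in Eu.
  rewrite perm_sym (perm_trans Eu) // perm_sym.
  apply: perm_trans (perm_cat Ehs Enh) _.
  rewrite -{1}(cat_take_drop k r) /w1.
  by perm_lia Eq0.
by rewrite (perm_size Eu) !size_cat size_takel // -size_cat addnA.
Qed.

End FewOutside.

(** * Many terms outside the kernel *)

Lemma cat_split (T : Type) (s1 s2 s3 s4 : seq T) : s1 ++ s2 = s3 ++ s4 ->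
  (exists e, s3 = s1 ++ e /\ s2 = e ++ s4) \/ (exists e, s1 = s3 ++ e /\ s4 = e ++ s2).
Proof.
elim: s1 s3 => [|z s1 IH] s3 /=; first by move=> ->; left; exists s3.
case: s3 => [|z3 s3] /=; first by move=> <-; right; exists (z :: s1).
by case=> -> /IH[[e [-> ->]] | [e [-> ->]]]; [left | right]; exists e.
Qed.

Lemma sum_count_mem (T : Type) (fT : finType) (f : T -> fT) (A : {set fT}) (s : seq T) :
  (\sum_(c in A) count (fun z => f z == c) s)%N = count (fun z => f z \in A) s.
Proof.
elim: s => [|z s IH] /=; first by rewrite big1.
rewrite big_split /= IH; congr (_ + _)%N.
have [Afz | nAfz] := boolP (f z \in A); last first.
  by rewrite big1 // => c Ac; case: eqP => // Ec; rewrite Ec Ac in nAfz.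
by rewrite (bigD1 (f z)) //= eqxx big1 // => c /andP[_ /negPf]; rewrite eq_sym => ->.
Qed.

Lemma prod_const_seq (gT : finGroupType) (T : Type) (s : seq T) (c : gT) :
  \prod_(z <- s) c = c ^+ size s.
Proof. by elim: s => [|z s IH]; rewrite ?big_nil // big_cons IH expgS. Qed.

Section ManyOutside.
Variables (gT : finGroupType) (G N : {group gT}) (p : nat).
Hypotheses (nNG : N <| G) (abN : abelian N) (pr_p : prime p) (iGN : #|G : N| = p).

Let nN z : z \in G -> z \in 'N(N).
Proof. exact: (subsetP (normal_norm nNG)). Qed.

Let cardGN : #|G / N| = p.
Proof. by rewrite card_quotient ?normal_norm. Qed.

Lemma coset_prod (s : seq gT) : {subset s <= G} ->
  coset N (\prod_(z <- s) z) = \prod_(z <- s) coset N z.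
Proof. by move=> Gs; rewrite big_seq morph_prod ?[RHS]big_seq // => z /Gs/nN. Qed.

Lemma coset_prod1 (s : seq gT) : {subset s <= G} ->
  coset N (\prod_(z <- s) z) = 1 -> \prod_(z <- s) z \in N.
Proof. by move=> Gs; apply: coset_idr; apply: nN; apply: group_prod_seq. Qed.

Definition full_block (t : seq gT) := (size t == p) && (\prod_(z <- t) z \in N).

(** All terms lie in one nontrivial coset of [N]; the default [1] of [head] rules out the empty
    list. *)
Definition twist_block (t : seq gT) :=
  [&& size t == p, coset N (head 1 t) != 1 & all (fun z => coset N z == coset N (head 1 t)) t].

Lemma twist_block_prod t : twist_block t -> {subset t <= G} -> \prod_(z <- t) z \in N.
Proof.
case/and3P=> /eqP szt _ /allP all_t Gt; apply: coset_prod1 => //; have p0 := prime_gt0 pr_p.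
rewrite coset_prod // (eq_big_seq (fun=> coset N (head 1 t))) => [|z /all_t/eqP//].
rewrite prod_const_seq szt -cardGN expg_cardG // mem_quotient // Gt //.
by case: t szt {all_t Gt} => [|z t _] /=; [move=> E; rewrite -E in p0 | rewrite mem_head].
Qed.

Lemma extract_full_blocks k (s : seq gT) :
    {subset s <= G} -> (k.-1 * p + (2 * p).-1 <= size s)%N || (k == 0%N) ->
  exists bs r, [/\ perm_eq s (flatten bs ++ r), size bs = k & all full_block bs].
Proof.
elim: k s => [|k IHk] s Gs; first by exists [::], s; rewrite perm_refl.
rewrite orbF /= => les; have p0 := prime_gt0 pr_p.
have [|||t [r [Es szt t1]]] := EGZ_cyclic (H := (G / N)%G) (f := coset N) (k := 1) (s := s).
- by apply: prime_cyclic; rewrite cardGN.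
- by move=> z sz; rewrite mem_quotient // Gs.
- by rewrite cardGN; apply: leq_trans les; move: p0; clear; lia.
rewrite cardGN mul1n in szt.
have Gt : {subset t <= G} by move=> z tz; rewrite Gs // (perm_mem Es) mem_cat tz.
have Gr : {subset r <= G} by move=> z tz; rewrite Gs // (perm_mem Es) mem_cat tz orbT.
have szs : size s = (p + size r)%N by rewrite (perm_size Es) size_cat szt.
have [|bs [r' [Er szbs all_bs]]] := IHk r Gr.
  by move: les; rewrite szs; move: (size r) => a; clear -p0; case: k => [|k] /=; nia.
exists (t :: bs), r'; split; rewrite /= ?szbs //.
  by rewrite (perm_trans Es) // -catA perm_cat2l.
by rewrite all_bs andbT /full_block szt eqxx coset_prod1 // coset_prod.
Qed.

(** There are [p - 1] nontrivial cosets, so more than [(p - 1) ^ 2] terms outside [N] put [p] terms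
    into one of them; each extraction uses up [p] such terms. *)
Lemma extract_twist_blocks k (s : seq gT) :
    {subset s <= G} ->
    (k.-1 * p + (p.-1 * p.-1).+1 <= count (fun z => z \notin N) s)%N || (k == 0%N) ->
  exists bs r, [/\ perm_eq s (flatten bs ++ r), size bs = k & all twist_block bs].
Proof.
elim: k s => [|k IHk] s Gs; first by exists [::], s; rewrite perm_refl.
rewrite orbF /= => les; have p0 := prime_gt0 pr_p.
have [c Ac ltc] : exists2 c, c \in (G / N)^# & (p.-1 < count (fun z => coset N z == c) s)%N.
  apply/exists_inP; apply: contraLR les => /exists_inPn le_c.
  have -> : count (fun z => z \notin N) s = count (fun z => coset N z \in (G / N)^#) s.
    apply: eq_in_count => z sz; rewrite !inE mem_quotient ?Gs // andbT; congr (~~ _).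
    by apply/idP/eqP => [/coset_id | /coset_idr->//]; last exact/nN/Gs.
  rewrite -sum_count_mem -ltnNge; apply: leq_ltn_trans (_ : p.-1 * p.-1 < _)%N.
    have -> : (p.-1 * p.-1 = \sum_(c in (G / N)^#) p.-1)%N.
      by rewrite sum_nat_const; congr (_ * _)%N; have := cardsD1 1 (G / N); rewrite group1 cardGN => ->.
    by apply: leq_sum => c /le_c; rewrite -leqNgt.
  by rewrite addnS ltnS leq_addl.
pose q := [seq z <- s | coset N z == c]; pose t := take p q.
have szt : size t = p by rewrite size_takel // size_filter -(prednK p0).
have tc z : z \in t -> coset N z = c by move/mem_take; rewrite mem_filter => /andP[/eqP].
have hdc : coset N (head 1 t) = c by apply: tc; case: t szt => [E|z t _]; [rewrite -E in p0 | apply: mem_head].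
have c1 : c != 1 by case/setD1P: Ac.
pose r := drop p q ++ [seq z <- s | coset N z != c].
have Es : perm_eq s (t ++ r).
  have := permEl (perm_filterC (fun z => coset N z == c) s); rewrite perm_sym => /perm_trans; apply.
  by rewrite catA cat_take_drop.
have Gr : {subset r <= G} by move=> z tz; rewrite Gs // (perm_mem Es) mem_cat tz orbT.
have ct : count (fun z => z \notin N) t = p.
  rewrite -szt; apply/eqP; rewrite -all_count; apply/allP=> z tz.
  by apply: contra c1 => Nz; rewrite -(tc z tz) coset_id.
have [|bs [r' [Er szbs all_bs]]] := IHk r Gr.
  move: les; rewrite (seq.permP Es) count_cat ct; move: (count _ r) => a; clear -p0.
  by case: k => [|k] /=; [rewrite orbT | rewrite orbF mulSn -addnA leq_add2l].
exists (t :: bs), r'; split; rewrite /= ?szbs //.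
  by rewrite (perm_trans Es) // -catA perm_cat2l.
by rewrite all_bs andbT /twist_block szt hdc eqxx c1; apply/allP=> z /tc->.
Qed.

(** The suffixes of [t] meet every coset of [N]: an element of [N] inserted before a suitable suffix
    is conjugated as by a prescribed [u]. *)
Definition absorbing (t : seq gT) := forall u, u \in G ->
  exists t1 t2, t = t1 ++ t2 /\ coset N (\prod_(z <- t2) z) = coset N u.

(** The common coset generates the quotient of prime order, and the suffixes realize all its powers
    up to [p]. *)
Lemma twist_block_absorbing t : twist_block t -> {subset t <= G} -> absorbing t.
Proof.
case/and3P=> /eqP szt c1 /allP all_t Gt u Gu; set c := coset N _ in c1 all_t.
have p0 := prime_gt0 pr_p.
have GNc : c \in G / N.
  by apply: mem_quotient; apply: Gt; case: t szt {c1 all_t} @c => [E|z t _] /=; [rewrite -E in p0 | rewrite mem_head].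
have gen_c : coset N u \in <[c]>.
  suff -> : <[c]> = G / N by apply: mem_quotient.
  apply/eqP; rewrite eqEcard cycle_subG GNc /=.
  have := cardSg (_ : <[c]> \subset G / N); rewrite cycle_subG cardGN => /(_ GNc).
  by case/primeP: (pr_p) => _ dvp /dvp /orP[|/eqP->//]; rewrite -[_ == _]trivg_card1 cycle_eq1 (negPf c1).
have [i lti Ei] := cyclePmin gen_c.
have lei : (i <= p)%N.
  by rewrite (leq_trans (ltnW lti)) // -cardGN subset_leq_card // cycle_subG.
exists (take (p - i) t), (drop (p - i) t); rewrite cat_take_drop; split=> //.
rewrite coset_prod => [|z /mem_drop/Gt//].
rewrite (eq_big_seq (fun=> c)) => [|z /mem_drop/all_t/eqP//].
by rewrite prod_const_seq size_drop szt subKn.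
Qed.

(** Insert [d] before a suffix [t2] with product [n * u], [n] in [N]; as [N] is abelian, [n] does
    not affect the conjugate. The result stays absorbing because [d] is trivial modulo [N]. *)
Lemma absorb (t d : seq gT) u :
    {subset t <= G} -> {subset d <= G} -> absorbing t -> \prod_(z <- d) z \in N -> u \in G ->
  exists t', [/\ perm_eq t' (t ++ d), absorbing t'
    & \prod_(z <- t') z = \prod_(z <- t) z * (\prod_(z <- d) z) ^ u].
Proof.
move=> Gt Gd abs_t Nd Gu; pose P (s : seq gT) := \prod_(z <- s) z.
have GP (s : seq gT) : {subset s <= G} -> P s \in G by apply: group_prod_seq.
have [t1 [t2 [Et Et2]]] := abs_t u Gu.
have Gt1 : {subset t1 <= G} by move=> z tz; rewrite Gt // Et mem_cat tz.
have Gt2 : {subset t2 <= G} by move=> z tz; rewrite Gt // Et mem_cat tz orbT.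
exists (t1 ++ d ++ t2); split.
- by rewrite Et -catA perm_cat2l perm_catC.
- move=> v Gv; have [t3 [t4 [Et' Et4]]] := abs_t v Gv.
  rewrite Et in Et'; case: (cat_split Et') => [[e [_ Ee]] | [e [Ee Ee']]].
    by exists (t1 ++ d ++ e), t4; rewrite Ee -!catA.
  exists t3, (e ++ d ++ t2); rewrite Ee -!catA; split=> //; rewrite -Et4 Ee'.
  have Ge : {subset e <= G} by move=> z ez; rewrite Gt1 // Ee mem_cat ez orbT.
  have Gcat (a b : seq gT) : {subset a <= G} -> {subset b <= G} -> {subset a ++ b <= G}.
    by move=> Ga Gb z; rewrite mem_cat => /orP[/Ga | /Gb].
  rewrite (coset_prod (Gcat _ _ Ge (Gcat _ _ Gd Gt2))) (coset_prod (Gcat _ _ Ge Gt2)).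
  by rewrite !big_cat /= -(coset_prod Gd) coset_id // mul1g.
- have [n Nn En] : exists2 n, n \in N & P t2 = n * u.
    have := introT (rcoset_kercosetP (nN (GP _ Gt2)) (nN Gu)) Et2.
    by case/rcosetP=> n Nn ->; exists n.
  have Edu : P d ^ u = P d ^ P t2.
    rewrite En conjgM; congr (_ ^ u); rewrite conjgE (centsP abN (P d) Nd n Nn).
    by rewrite mulKg.
  by rewrite -/(P d) Edu Et !big_cat /= -/(P d) -/(P t2) -!mulgA -conjgC.
Qed.

Lemma absorb_seq (t : seq gT) (ds : seq (seq gT * gT)) :
    {subset t <= G} -> absorbing t ->
    (forall d, d \in ds -> [/\ {subset d.1 <= G}, \prod_(z <- d.1) z \in N & d.2 \in G]) ->
  exists2 t', perm_eq t' (t ++ flatten (map fst ds))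
    & \prod_(z <- t') z = \prod_(z <- t) z * \prod_(d <- ds) (\prod_(z <- d.1) z) ^ d.2.
Proof.
elim: ds t => [|d ds IH] t Gt abs_t Hds.
  by exists t; rewrite ?cats0 // big_nil mulg1.
have [Gd Nd Gd2] := Hds d (mem_head _ _).
have [t' [Et' abs_t' Pt']] := absorb Gt Gd abs_t Nd Gd2.
have [|| t'' Et'' Pt''] := IH t' _ abs_t'.
- by move=> z; rewrite (perm_mem Et') mem_cat => /orP[/Gt | /Gd].
- by move=> e dse; apply: Hds; rewrite inE dse orbT.
exists t''; last by rewrite Pt'' Pt' big_cons; apply/esym/mulgA.
by rewrite (perm_trans Et'') //= catA perm_cat2r.
Qed.

End ManyOutside.

Lemma conjg_prod (gT : finGroupType) (T : Type) (f : T -> gT) (s : seq T) g :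
  (\prod_(z <- s) f z) ^ g = \prod_(z <- s) f z ^ g.
Proof. by elim: s => [|z s IH]; rewrite ?big_nil ?conj1g // !big_cons conjMg IH. Qed.

Lemma product_one_many_outside (gT : finGroupType) (G : {group gT}) (x y : gT) p r (s : seq gT) :
    let m := #[y] in
    prime p -> <[y]> <| G -> #|G : <[y]>| = p -> x \in G -> y ^ x = y ^+ r ->
    (r ^ p)%N = 1 %[mod m] -> (forall q, prime q -> q %| m -> r <> 1 %[mod q]) ->
    (1 < m)%N -> {subset s <= G} -> size s = (p * m + m + p - 2)%N ->
    (m + p.-1 * p.-1 <= count (fun z => z \notin <[y]>) s)%N ->
  exists t u, [/\ perm_eq s (t ++ u), size t = (p * m)%N & \prod_(z <- t) z = 1].
Proof.
move=> m pr_p nNG iGN Gx yx rp r1 m1 Gs szs les; have abN := cycle_abelian y.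
have [dvpm _] := orbit_EGZ pr_p (ltnW m1) rp r1; have p0 := prime_gt0 pr_p.
have /esym Em1 := divnK dvpm; set k := m.-1 %/ p in Em1.
have [|bs1 [s1 [Es szbs1 tw1]]] := extract_twist_blocks nNG pr_p iGN (k := k.+1) Gs.
  by rewrite orbF /= -Em1 addnS -addSn prednK // ltnW.
have Gbs1 b : b \in bs1 -> {subset b <= G}.
  by move=> bs1b z bz; rewrite Gs // (perm_mem Es) mem_cat; apply/orP; left; apply/flattenP; exists b.
have Gs1 : {subset s1 <= G} by move=> z sz; rewrite Gs // (perm_mem Es) mem_cat sz orbT.
have szflat (bs : seq (seq gT)) : all (fun b => size b == p) bs -> size (flatten bs) = (size bs * p)%N.
  by elim: bs => //= b bs IH /andP[/eqP szb /IH]; rewrite size_cat szb => ->.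
have szb1 : all (fun b => size b == p) bs1 by apply: sub_all tw1 => b /and3P[].
have szs1 : (k.+1 * p + size s1 = p * m + m + p - 2)%N.
  by rewrite -szs (perm_size Es) size_cat szflat // szbs1.
(* With the [k + 1] twist blocks this makes [m + k] blocks, the number that [orbit_EGZ_cyclic]
   requires. *)
have [|bs2 [s2 [Es1 szbs2 fb2]]] := extract_full_blocks nNG pr_p iGN (k := m.-1) Gs1.
  have aux n a : (1 < n -> p + n.-1 + a = p * n + n + p - 2 -> n.-1.-1 * p + (2 * p).-1 <= a)%N.
    by move: p0; clear; case: n => [|[|n]] //=; nia.
  by apply/orP; left; apply: aux m1 _; rewrite Em1 -mulSn.
have Gbs2 b : b \in bs2 -> {subset b <= G}.
  by move=> bs2b z bz; rewrite Gs1 // (perm_mem Es1) mem_cat; apply/orP; left; apply/flattenP; exists b.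
have Gbs b : b \in bs1 ++ bs2 -> {subset b <= G} by rewrite mem_cat => /orP[/Gbs1 | /Gbs2].
have Nbs b : b \in bs1 ++ bs2 -> \prod_(z <- b) z \in <[y]>.
  rewrite mem_cat => /orP[b1 | /(allP fb2)/andP[] //].
  by apply: (twist_block_prod nNG pr_p iGN) (allP tw1 b b1) (Gbs1 b b1).
have szb b : b \in bs1 ++ bs2 -> size b = p.
  by rewrite mem_cat => /orP[/(allP szb1)/eqP | /(allP fb2)/andP[/eqP]].
have [|ps [bs3 [Ebs szps prod1]]] := orbit_EGZ_cyclic pr_p yx rp r1 Nbs.
  by rewrite size_cat szbs1 szbs2 -/m -/k addSn -addnS prednK 1?addnC // ltnW.
have szbs3 : size bs3 = k.
  have := perm_size Ebs; rewrite !size_cat size_map szps szbs1 szbs2 -/m.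
  by rewrite addSn -addnS prednK 1?ltnW // addnC => /addnI.
(* Only [k] blocks remain unselected, so one of the [k + 1] twist blocks is selected. *)
have [[b i0] psb twb] : exists2 z, z \in ps & twist_block <[y]> p z.1.
  apply/hasP; rewrite -[has _ _]has_map has_count.
  have : (k.+1 <= count (twist_block <[y]> p) (bs1 ++ bs2))%N.
    by rewrite count_cat -szbs1; have := tw1; rewrite all_count => /eqP->; apply: leq_addr.
  rewrite (seq.permP Ebs) count_cat; have := count_size (twist_block <[y]> p) bs3; rewrite szbs3.
  by move: (count _ _) (count _ _) => a1 a2; clear; lia.
have psE z : z \in ps -> z.1 \in bs1 ++ bs2.
  by move=> psz; rewrite (perm_mem Ebs) mem_cat map_f.
case/splitPr: psb Ebs szps prod1 psE => ps1 ps2 Ebs szps prod1 psE.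
have psb : (b, i0) \in ps1 ++ (b, i0) :: ps2 by rewrite mem_cat mem_head orbT.
have ps12 z : z \in ps1 ++ ps2 -> z \in ps1 ++ (b, i0) :: ps2.
  by rewrite !mem_cat inE => /orP[]->; rewrite ?orbT.
(* The host block [b] is not itself conjugated, so every conjugation is taken relative to its own
   exponent [i0]. *)
pose ds := [seq (z.1, x ^+ z.2 * (x ^+ i0)^-1) | z <- ps1 ++ ps2].
have [||t Et Pt] := absorb_seq nNG abN (t := b) (ds := ds) (Gbs _ (psE _ psb)).
- exact: (twist_block_absorbing nNG pr_p iGN twb (Gbs _ (psE _ psb))).
- move=> _ /mapP[z zps ->] /=; have zbs := psE z (ps12 z zps).
  by split; [apply: Gbs | apply: Nbs | rewrite groupM ?groupV ?groupX].
have Eps : perm_eq (bs1 ++ bs2) (b :: map fst (ps1 ++ ps2) ++ bs3).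
  apply: perm_trans Ebs _; rewrite !map_cat /=.
  by apply/seq.permP=> Q; do 3!rewrite /= ?count_cat; clear; lia.
have Eds : map fst ds = map fst (ps1 ++ ps2) by rewrite -map_comp.
rewrite Eds in Et.
exists t, (flatten bs3 ++ s2); split.
- apply: perm_trans Es _; rewrite -(perm_cat2l (flatten bs1)) in Es1.
  apply: perm_trans Es1 _; rewrite !catA perm_cat2r -flatten_cat.
  have /perm_trans := perm_flatten Eps; apply.
  by rewrite /= flatten_cat catA perm_cat2r perm_sym.
- rewrite (perm_size Et) size_cat (szb _ (psE _ psb)) szflat.
    by rewrite size_map; move: szps; rewrite !size_cat /= addnS -/m => <-; rewrite mulnC mulnS.
  by apply/allP=> _ /mapP[z zps ->]; apply/eqP/szb/psE/ps12.
pose F (z : seq gT * nat) := (\prod_(c <- z.1) c) ^ (x ^+ z.2).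
have NF z : z \in ps1 ++ (b, i0) :: ps2 -> F z \in <[y]>.
  by move=> zps; rewrite memJ_norm ?Nbs ?psE // (subsetP (normal_norm nNG)) ?groupX.
have prodF : F (b, i0) * \prod_(z <- ps1 ++ ps2) F z = 1.
  rewrite -[RHS]prod1; transitivity (\prod_(z <- (b, i0) :: (ps1 ++ ps2)) F z); first by rewrite big_cons.
  apply: (prod_perm_abelian (f := F) abN) => [z|].
    by rewrite inE => /orP[/eqP-> | /ps12]; apply: NF.
  by rewrite -cat1s perm_catCA.
rewrite Pt; apply: (conjg_inj (x ^+ i0)); rewrite conj1g -[RHS]prodF conjMg; congr (_ * _).
rewrite big_map conjg_prod.
by apply: eq_bigr => z _; rewrite /F -conjgM mulgKV.
Qed.

(** * Metacyclic groups *)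

(** Passes from the integer [r] to its residue. A prime [q] dividing [m] with [rho] congruent to [1]
    would divide [r - 1], against coprimality. *)
Lemma residue_arith (p m : nat) (r : int) : (0 < m)%N -> prime p ->
    (r ^+ p = 1 %[mod m%:Z])%Z -> coprimez (p%:Z * (r - 1)) m%:Z ->
  let rho := `|(r %% m%:Z)%Z|%N in
  (rho ^ p)%N = 1 %[mod m] /\ forall q, prime q -> q %| m -> rho <> 1 %[mod q].
Proof.
move=> m0 pr_p rp cop rho.
have mz : (m%:Z != 0)%R by rewrite eqz_nat -lt0n.
have rhoE : (rho%:Z = (r %% m%:Z)%Z)%R by rewrite /rho gez0_abs ?modz_ge0.
split.
  apply/eqP; rewrite -eqz_nat -!modz_nat; apply/eqP.
  have -> : ((rho ^ p)%N%:Z = rho%:Z ^+ p)%R by rewrite -natz natrX natz.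
  by rewrite rhoE modzXm.
move=> q pr_q dvqm /eqP Erho; have q1 := prime_gt1 pr_q.
have dvr : (q%:Z %| (r - 1)%R)%Z.
  have -> : (r - 1 = (r %/ m%:Z)%Z * m%:Z + (rho%:Z - 1))%R by rewrite rhoE addrA -divz_eq.
  rewrite rpredD ?dvdz_mull //.
  by rewrite -eqz_mod_dvd !modz_nat eqz_nat.
have : (q%:Z %| gcdz (p%:Z * (r - 1)) m%:Z)%Z by rewrite dvdz_gcd dvdz_mull.
by rewrite (eqP cop) dvdz1 /= gtn_eqF.
Qed.

Lemma subsequence_of_perm (gT : finGroupType) (s t r : seq gT) :
  perm_eq s (t ++ r) -> exists2 u, subsequence u s & perm_eq u t.
Proof.
move=> Es; have /count_subseqP[u /subseqP[b _ Eu] Etu] :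
    forall z, count_mem z t <= count_mem z s.
  by move=> z; rewrite (seq.permP Es) count_cat leq_addr.
by exists u; [exists b | rewrite perm_sym].
Qed.

Lemma perm_of_subsequence (gT : finGroupType) (s u : seq gT) :
  subsequence u s -> exists r, perm_eq s (u ++ r).
Proof. by case=> b ->; have [r Er] := perm_to_subseq (mask_subseq b s); exists r. Qed.

Section Metacyclic.
Variables (gT : finGroupType) (G : {group gT}) (x y : gT) (p m r : nat).
Hypotheses (pr_p : prime p) (m0 : 0 < m).
Hypotheses (genG : G :=: <<[set x; y]>>) (xp : x ^+ p = 1) (ym : y ^+ m = 1).
Hypotheses (yx : y ^ x = y ^+ r) (cardG : #|G| = (p * m)%N).
Hypotheses (rp : (r ^ p)%N = 1 %[mod m]) (r1 : forall q, prime q -> q %| m -> r <> 1 %[mod q]).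

Let Gx : x \in G. Proof. by rewrite genG mem_gen // !inE eqxx. Qed.
Let Gy : y \in G. Proof. by rewrite genG mem_gen // !inE eqxx orbT. Qed.

Lemma normal_cycle_y : <[y]> <| G.
Proof.
rewrite /normal cycle_subG Gy genG gen_subG subUset !sub1set.
rewrite (subsetP (normG <[y]>) y (cycle_id y)) andbT /=.
have sJ : <[y]> :^ x \subset <[y]> by rewrite -cycleJ cycle_subG yx mem_cycle.
by rewrite inE.
Qed.

(** The relations bound the orders by [p] and [m], while [G = <[y]> * <[x]>] forces their product to
    be at least [p * m]. *)
Lemma orders : #[x] = p /\ #[y] = m.
Proof.
have GE : G :=: <[y]> * <[x]>.
  rewrite -norm_joinEr ?cycle_subG ?(subsetP (normal_norm normal_cycle_y)) //.
  by rewrite genG /cycle joing_idl joing_idr joingE setUC.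
have ox : (#[x] <= p)%N by apply: dvdn_leq; rewrite ?prime_gt0 // order_dvdn xp.
have oy : (#[y] <= m)%N by apply: dvdn_leq; rewrite // order_dvdn ym.
have leG : (p * m <= #[y] * #[x])%N.
  by rewrite -cardG GE !orderE mul_cardG leq_pmulr ?cardG_gt0.
have p0 := prime_gt0 pr_p; have ox0 := order_gt0 x; have oy0 := order_gt0 y.
by split; apply/eqP; rewrite eqn_leq ?ox ?oy /=; move: leG ox oy p0 m0 ox0 oy0; clear; nia.
Qed.

Let ox : #[x] = p. Proof. by case: orders. Qed.
Let oy : #[y] = m. Proof. by case: orders. Qed.

Lemma index_cycle_y : #|G : <[y]>| = p.
Proof. by rewrite -divgS ?normal_sub ?normal_cycle_y // cardG -orderE oy mulnK. Qed.

Lemma x_notin_cycle_y : x \notin <[y]>.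
Proof.
apply/negP=> Nx; have := index_cycle_y; have -> : G :=: <[y]>.
  by apply/eqP; rewrite genG eqEsubset gen_subG subUset !sub1set Nx cycle_id cycle_subG mem_gen // !inE eqxx orbT.
by rewrite indexgg => E; have := prime_gt1 pr_p; rewrite -E.
Qed.

(* The centralizer of [c] contains [<[y]>] and [g], hence all of [G] as [<[y]>]
   has prime index; then [c = c ^ x = c ^+ r] forces [c = 1]. *)
Lemma cycle_y_free g c : g \in G -> g \notin <[y]> -> c \in <[y]> -> c ^ g = c -> c = 1.
Proof.
move=> Gg nNg Nc cg; pose C := 'C_G[c]%G; have sCG : C \subset G by apply: subsetIl.
have sNC : <[y]> \subset C.
  rewrite cycle_subG inE Gy; apply/cent1P.
  by apply: (centsP (cycle_abelian y)); rewrite ?cycle_id.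
have Cg : g \in C by rewrite inE Gg; apply/cent1P; rewrite /commute [RHS]conjgC cg.
have CE : C :=: G.
  have := Lagrange_index sCG sNC; rewrite index_cycle_y => E.
  apply/eqP; rewrite eqEsubset sCG /= -indexg_eq1.
  have : #|C : <[y]>| %| p by rewrite -E dvdn_mull.
  case/primeP: (pr_p) => _ dvp /dvp /orP[]/eqP EC.
    have /subsetP/(_ g Cg) : C \subset <[y]> by rewrite -indexg_eq1 EC.
    by rewrite (negPf nNg).
  by move: E; rewrite EC -{2}[p]mul1n => /eqP; rewrite eqn_pmul2r ?prime_gt0.
have cx : c ^ x = c.
  have : x \in C by rewrite CE.
  by rewrite inE => /andP[_ /cent1P xc]; rewrite conjgE -xc mulKg.
have cr : c ^+ r = c ^+ 1.
  by rewrite expg1 -[RHS]cx; case/cycleP: Nc => k ->; rewrite conjXg yx -!expgM mulnC.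
have /eqP rc : r == 1 %[mod #[c]] by rewrite -eq_expg_mod_order cr.
apply/eqP; rewrite -order_eq1 eqn_leq order_gt0 andbT leqNgt; apply/negP=> c1.
apply: (r1 (pdiv_prime c1)); last by rewrite -(modn_dvdm r (pdiv_dvd #[c])) rc modn_dvdm ?pdiv_dvd.
by rewrite (dvdn_trans (pdiv_dvd _)) // -oy order_dvdG.
Qed.

Lemma davenport_upper (s : seq gT) : {subset s <= G} -> (m + p <= (size s).+1)%N ->
  exists t u, [/\ perm_eq s (t ++ u), t != [::] & \prod_(z <- t) z = 1].
Proof.
move=> Gs les; apply: (davenport (f := id) normal_cycle_y (cycle_abelian y) cycle_y_free) => //.
by rewrite index_cycle_y -orderE oy.
Qed.

Lemma EGZ_upper (s : seq gT) : {subset s <= G} -> size s = (m + p - 2 + p * m)%N ->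
  exists t u, [/\ perm_eq s (t ++ u), size t = (p * m)%N & \prod_(z <- t) z = 1].
Proof.
move=> Gs szs; have p1 := prime_gt1 pr_p.
(* For [m = 1] the group is cyclic of order [p] and the length is [2 * p - 1]. *)
have [m1 | m_neq1] := eqVneq m 1%N.
  have [|||t [u [Es szt t1]]] := EGZ_cyclic (H := G) (f := id) (k := 1) (s := s).
  - by apply: prime_cyclic; rewrite cardG m1 muln1.
  - exact: Gs.
  - by rewrite szs cardG m1 !muln1; move: p1; clear; lia.
  by exists t, u; rewrite szt cardG mul1n.
have m_gt1 : (1 < m)%N by rewrite ltn_neqAle eq_sym m_neq1.
have szs' : size s = (p * m + m + p - 2)%N by rewrite szs; move: p1; clear; lia.
have [les | lts] := leqP (m + p.-1 * p.-1) (count (fun z => z \notin <[y]>) s).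
  rewrite -oy; apply: (product_one_many_outside pr_p normal_cycle_y index_cycle_y Gx yx) => //; rewrite ?oy //.
have [dvp _] := orbit_EGZ pr_p m0 rp r1.
have ltpm : (p < m)%N.
  have /dvdn_leq : p %| m.-1 by []; rewrite -subn1 subn_gt0 => /(_ m_gt1).
  by move: m_gt1; clear; lia.
have := product_one_few_outside normal_cycle_y (cycle_cyclic y) p1 index_cycle_y cycle_y_free Gs.
by rewrite -orderE oy; apply.
Qed.

(** * Extremal sequences for the lower bounds *)

Lemma x_neq_y : x != y.
Proof. by apply: contraNneq x_notin_cycle_y => ->; apply: cycle_id. Qed.

(** Modulo [<[y]>] the product is a power of [x], so [p] divides the number of [x], which is then
    [0]; what remains is a power of [y] with exponent below [m]. *)
Lemma product_one_free_pairs (t : seq gT) :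
    {subset t <= [:: y; x]} -> (count_mem y t < m)%N -> (count_mem x t < p)%N ->
  \prod_(z <- t) z = 1 -> t = [::].
Proof.
move=> sub_t lt_y lt_x t1; pose N := <[y]>%G.
have nN : G \subset 'N(N) := normal_norm normal_cycle_y.
have nx : x \in 'N(N) by apply: (subsetP nN).
have oNx : #[coset N x] = p.
  have : #[coset N x] %| p by rewrite order_dvdn -morphX // xp morph1.
  case/primeP: (pr_p) => _ dvp /dvp /orP[|/eqP//].
  by rewrite order_eq1 => /eqP/(coset_idr nx); rewrite (negPf x_notin_cycle_y).
have cosetE s : {subset s <= [:: y; x]} -> coset N (\prod_(z <- s) z) = coset N x ^+ count_mem x s.
  elim: s => [|z s IH] sub_s; first by rewrite big_nil morph1.
  have sub_s' : {subset s <= [:: y; x]} by move=> c sc; rewrite sub_s // inE sc orbT.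
  have Gs : \prod_(c <- s) c \in G.
    by apply: group_prod_seq => c /sub_s'; rewrite !inE => /orP[]/eqP->.
  have := sub_s z (mem_head _ _); rewrite big_cons !inE => /orP[]/eqP-> /=.
    by rewrite morphM ?(subsetP nN) //= IH // coset_id ?cycle_id // mul1g eq_sym (negPf x_neq_y).
  by rewrite morphM ?(subsetP nN) //= IH // eqxx expgS.
have : p %| count_mem x t by rewrite -oNx order_dvdn -cosetE // t1 morph1.
rewrite /dvdn modn_small // => /eqP x0.
have ty : t = nseq (size t) y.
  apply/all_pred1P/allP=> z tz; have := sub_t z tz; rewrite !inE => /orP[-> // | /eqP Ez].
  by have /count_memPn := x0; rewrite -Ez tz.
have yt : \prod_(z <- t) z = y ^+ size t.
  by rewrite -prod_const_seq; apply: eq_big_seq => z; rewrite {1}ty => /nseqP[].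
move: lt_y; rewrite ty count_nseq /= eqxx mul1n => lt_t.
move/eqP: t1; rewrite yt -order_dvdn oy /dvdn modn_small // => /eqP t0.
by rewrite ty t0.
Qed.

Definition extremal := nseq m.-1 y ++ nseq p.-1 x.

Lemma extremal_free : product_one_free extremal.
Proof.
move=> T /perm_of_subsequence[u Eu] T0 [t [Et t1]]; apply: T0.
have t_ext z : z \in t -> z \in extremal by rewrite (perm_mem Et) (perm_mem Eu) mem_cat => ->.
have cnt z : (count_mem z t <= count_mem z extremal)%N.
  by rewrite (seq.permP Et) (seq.permP Eu) count_cat leq_addr.
suff t0 : t = [::] by apply/perm_nilP; rewrite perm_sym -t0.
apply: product_one_free_pairs t1.
- by move=> z /t_ext; rewrite mem_cat !inE => /orP[] /nseqP[-> _]; rewrite eqxx ?orbT.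
- apply: leq_ltn_trans (cnt y) _.
  by rewrite count_cat !count_nseq /= eqxx (negPf x_neq_y) mul1n mul0n addn0 prednK.
- apply: leq_ltn_trans (cnt x) _.
  by rewrite count_cat !count_nseq /= eqxx eq_sym (negPf x_neq_y) mul1n mul0n add0n prednK ?prime_gt0.
Qed.

(** Pad the extremal sequence with [p * m - 1] copies of [1] and take a prefix. Deleting the [1]s
    from a product-one subsequence of length [p * m] leaves a product-one subsequence of the
    extremal sequence, hence nothing; but there are too few [1]s. *)
Lemma EGZ_lower t' : (t' < m + p - 2 + p * m)%N -> ~ E_prop G t'.
Proof.
move=> ltt; have p1 := prime_gt1 pr_p; pose S1 := extremal ++ nseq (p * m).-1 1.
have szS1 : size S1 = (m + p - 2 + p * m).-1.
  have : (0 < p * m)%N by rewrite muln_gt0 prime_gt0.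
  by rewrite !size_cat !size_nseq; move: p1 m0; move: (p * m)%N; clear; lia.
have GS1 : {subset S1 <= G}.
  by move=> z; rewrite !mem_cat => /orP[/orP[] | ] /nseqP[-> _].
move/(_ (take t' S1)) => [||T [/perm_of_subsequence[u Eu] [szT [t [Et t1]]]]].
- by apply/allP=> z /mem_take/GS1.
- by rewrite size_takel // szS1; move: ltt; clear; lia.
have cnt z : (count_mem z T <= count_mem z S1)%N.
  rewrite -(cat_take_drop t' S1) [in X in (_ <= X)%N]count_cat (seq.permP Eu) count_cat -addnA.
  exact: leq_addr.
pose T' := [seq z <- T | z != 1].
have /count_subseqP[v sub_v Ev] : forall z, (count_mem z T' <= count_mem z extremal)%N.
  move=> z; have [-> | z1] := eqVneq z 1.
    by rewrite (count_memPn _) // mem_filter eqxx.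
  apply: leq_trans (_ : count_mem z S1 <= _)%N.
    by apply: leq_trans (cnt z); rewrite count_filter; apply: sub_count => c /andP[].
  by rewrite count_cat count_nseq /= eq_sym (negPf z1) addn0.
have v0 : v = [::].
  apply/eqP/negPn/negP=> /eqP v_n0; case/subseqP: sub_v => b _ Eb.
  apply: (extremal_free (T := v)) => //; first by exists b.
  exists [seq z <- t | z != 1]; split; last first.
    by rewrite big_filter big_mkcond -[RHS]t1; apply: eq_bigr => z _; case: eqP.
  by rewrite perm_sym -(permPl Ev) perm_sym perm_filter.
have allT : count_mem 1 T = size T.
  have T'0 : T' = [::] by apply/perm_nilP; rewrite -v0.
  apply/eqP; rewrite -all_count; apply/allP=> z Tz; apply/negPn/negP=> z1.
  by have : z \in T' by [rewrite mem_filter Tz andbT]; rewrite T'0.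
have := cnt 1; rewrite allT szT cardG count_cat count_nseq /= eqxx mul1n.
have -> : count_mem 1 extremal = 0%N.
  have x1 : x != 1 by apply: contraNneq x_notin_cycle_y => ->; apply: group1.
  rewrite count_cat !count_nseq /= (negPf x1) addn0.
  by rewrite -order_eq1 oy; case: m m0 => [|[]].
rewrite add0n leqNgt prednK ?leqnn //.
by rewrite muln_gt0 prime_gt0.
Qed.

End Metacyclic.

Local Close Scope group_scope.

Theorem theorem1p4 (gT : finGroupType) (G : {group gT}) (x y : gT)
    (p m : nat) (r : int) :
  prime p -> 1 <= m ->
  (r ^+ p = 1 %[mod m%:Z])%Z ->
  (* G = < x, y | x^p = y^m = 1, x^-1 y x = y^r >, of order p m *)
  G :=: <<[set x; y]>>%g ->
  (x ^+ p = 1)%g -> (y ^+ m = 1)%g ->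
  (y ^ x = y ^+ `|(r %% m%:Z)%Z|%N)%g ->
  #|G| = p * m ->
  (* p is the smallest prime divisor of |G| *)
  (forall q : nat, prime q -> q %| #|G| -> p <= q) ->
  coprimez (p%:Z * (r - 1)) m%:Z ->
  is_small_davenport G (m + p - 2) /\ is_E_const G (m + p - 2 + #|G|).
Proof.
move=> pr_p m0 rp genG xp ym yx cardG _ cop.
have [rhop rho1] := residue_arith m0 pr_p rp cop.
have p1 := prime_gt1 pr_p.
have UE := EGZ_upper pr_p m0 genG xp ym yx cardG rhop rho1.
have UD := davenport_upper pr_p m0 genG xp ym yx cardG rho1.
split; split.
- exists (extremal x y p m); split; last split.
  + by apply/allP=> z; rewrite mem_cat genG => /orP[] /nseqP[-> _]; apply: mem_gen; rewrite !inE eqxx ?orbT.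
  + by rewrite size_cat !size_nseq; move: p1 m0; clear; lia.
  + exact: (extremal_free pr_p m0 genG xp ym yx cardG).
- move=> l ltl [S [/allP GS [szS freeS]]].
  have [|t [u [ES t0 t1]]] := UD S GS; first by rewrite szS; move: ltl p1; clear; lia.
  have [T subT ET] := subsequence_of_perm ES.
  apply: (freeS T subT); first by move=> T0; move: (perm_size ET) t0; rewrite T0; case: t {t1 ES ET}.
  by exists t; rewrite perm_sym.
- move=> S /allP GS szS; rewrite cardG in szS.
  have [t [u [ES szt t1]]] := UE S GS szS.
  have [T subT ET] := subsequence_of_perm ES.
  exists T; rewrite (perm_size ET) szt cardG; split=> //; split=> //.
  by exists t; rewrite perm_sym.
- by move=> t'; rewrite cardG; apply: (EGZ_lower pr_p m0 genG xp ym yx cardG).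
Qed.
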